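(* Let $G$ be a triangle-free graph with $n\ge 4$ vertices, and write $n=4t+r$ with $t$ a positive integer and $r\in\{0,1,2,3\}$. Then $\phi(G)\le 6^t$ if $r=0$; $\phi(G)\le 8\cdot 6^{t-1}$ if $r=1$; $\phi(G)\le 11\cdot 6^{t-1}$ if $r=2$; $\phi(G)\le 3\cdot 6^{t}$ if $r=3$. Equality holds if and only if $G\cong tC_4$ (for $r=0$), $G\cong K_{2,3}\cup(t-1)C_4$ (for $r=1$), $G\cong K_{3,3}\cup(t-1)C_4$ (for $r=2$), $G\cong P_3\cup tC_4$ (for $r=3$).
   Context: A subset $F$ of vertices of a graph $G$ is a dissociation set if $G[F]$ has maximum degree at most $1$; a maximal dissociation set is one not properly contained in another dissociation set; $\phi(G)$ is the number of maximal dissociation sets of $G$. $\ell H$ denotes the disjoint union of $\ell$ copies of $H$ and $\cup$ denotes disjoint union; $P_3$ is the path on 3 vertices, $C_4$ the 4-cycle, $K_{a,b}$ the complete bipartite graph. *)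

(* Defs.v *)
From mathcomp Require Import all_boot.
Set Implicit Arguments. Unset Strict Implicit. Unset Printing Implicit Defensive.

Definition simple_graph (T : finType) (e : rel T) : Prop :=
  symmetric e /\ irreflexive e.

Definition triangle_free (T : finType) (e : rel T) : Prop :=
  forall x y z : T, e x y -> e y z -> e z x -> False.

Definition dissociation (T : finType) (e : rel T) (F : {set T}) : bool :=
  [forall x in F, #|[set y in F | e x y]| <= 1].

Definition phi (T : finType) (e : rel T) : nat :=
  #|[set F : {set T} | maxset (dissociation e) F]|.

Definition graph_iso (T U : finType) (e : rel T) (f : rel U) : Prop :=
  exists h : T -> U, bijective h /\ forall x y, f (h x) (h y) = e x y.

(* Disjoint copies of C4 on the vertices k, k+1, ...: block (i-k)/4, and inside
   a block the positions 0,1,2,3 in cyclic order, adjacent iff parities differ. *)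
Definition c4s (k : nat) : rel nat := fun i j =>
  [&& k <= i, k <= j, (i - k) %/ 4 == (j - k) %/ 4 & odd (i - k) != odd (j - k)].

Definition tC4_rel : rel nat := c4s 0.
Definition K23_C4_rel : rel nat := fun i j =>
  [&& i < 5, j < 5 & (i < 2) != (j < 2)] || c4s 5 i j.
Definition K33_C4_rel : rel nat := fun i j =>
  [&& i < 6, j < 6 & (i < 3) != (j < 3)] || c4s 6 i j.
(* P3 = 0-1-2, union t C4 on vertices >= 3 *)
Definition P3_C4_rel : rel nat := fun i j =>
  [&& i < 3, j < 3 & (i + j == 1) || (i + j == 3)] || c4s 3 i j.

Arguments graph_iso : clear implicits.
Definition ord_graph (n : nat) (g : rel nat) : rel 'I_n := fun i j => g i j.
Arguments ord_graph : clear implicits.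

(* Main.v *)
Require Import Defs.
From Stdlib Require Import NArith.
From mathcomp Require Import all_boot zify.
Set Implicit Arguments. Unset Strict Implicit. Unset Printing Implicit Defensive.

(* Induction on the number of vertices.  If [I] is part of a maximal dissociation
   set [F] of [G] and no vertex of [F \ I] is adjacent to [I], then [F \ I] is a
   maximal dissociation set of [G] minus [I] and its neighbours.  Deciding, for a
   few vertices, whether they are outside [F], isolated in [F] or matched in [F]
   therefore bounds phi(G) by a sum of values of phi on smaller graphs.

   A vertex of degree at least 8 is enough for one such step.  Otherwise start from
   a vertex of minimum degree when that degree is at most 2, and from a vertex of
   maximum degree when all degrees are at least 3, and explore its surroundings:
   each local structure that occurs either admits a choice of decisions whose sum
   is small enough, or closes up into a connected component P3, C4, K_{2,3} or
   K_{3,3}, which splits off because phi is multiplicative.  These explorations are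
   stored as certificates and checked by computation.

   The bound for n = 2 mod 4 is the tightest.  When all degrees are at least 3 and
   the maximum degree is 4, it follows from a step at a vertex of degree 4, using
   that for n = 0, 1 mod 4 a graph that is not extremal stays below 23/24 of the
   maximum. *)

(** * Maximal dissociation sets of induced subgraphs *)

(** The induction proves a dichotomy: an induced subgraph is extremal ([ext]) or misses the bound by
    a margin ([gap]). Every counting step is strict and yields [gap], so extremal graphs arise only
    from the empty graph by restoring components; this gives the equality case together with the
    bound. The constant 23/24 comes from n = 4c + 10 with all degrees at least 3 and a vertex of
    degree 4. Values are multiplied by 6, as in [f]. The step gives f(n-1) + f(n-5) + 4 f(n-7) =
    (288 + 48 + 72) 6^c, more than f(n) = 396 * 6^c. With 288 lowered to 23/24 * 288 = 276 the sum
    is exactly 396, so a strict gap of that ratio in residue 1 suffices. Residue 0 needs the same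
    ratio because removing K_{2,3} from a graph of residue 1 leaves residue 0. In residues 2 and 3
    plain strictness is enough. Since f(n+4) = 6 f(n), each inequality to be checked depends on n
    only through n mod 4; it is evaluated at n = 16 + r. With all degrees at most 7 the explorations
    are finite. *)

Section Graph.
Variables (T : finType) (e : rel T).
Hypothesis (sym : symmetric e) (irr : irreflexive e) (tri : triangle_free e).

Implicit Types (S F X D I : {set T}).

Lemma dissP F :
  reflect (forall x y z, x \in F -> y \in F -> z \in F -> e x y -> e x z -> y = z)
          (dissociation e F).
Proof.
apply: (iffP forall_inP) => [H x y z xF yF zF xy xz|H x xF].
  have /card_le1_eqP := H x xF; apply; by rewrite inE ?yF ?zF.
apply/card_le1_eqP => y z; rewrite !inE => /andP[yF xy] /andP[zF xz].
exact: (H x).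
Qed.

Lemma dissS F X : X \subset F -> dissociation e F -> dissociation e X.
Proof.
move=> /subsetP XF /dissP H; apply/dissP => x y z /XF xF /XF yF /XF zF.
exact: H.
Qed.

(** Induced subgraphs are represented by their vertex sets [S] in the fixed type [T], so that the
    induction deletes vertices without changing type or relation. *)
Definition mds S F := maxset (fun X => (X \subset S) && dissociation e X) F.
Definition phis S := #|[set F | mds S F]|.

Lemma mdsP S F : reflect
  [/\ F \subset S, dissociation e F
    & forall x, x \in S -> x \notin F -> ~~ dissociation e (x |: F)]
  (mds S F).
Proof.
apply: (iffP maxsetP) => [[/andP[FS dF] H]|[FS dF H]].
  split=> // x xS xF; apply/negP => d.
  have /setP/(_ x) : x |: F = F.
    by apply: H; rewrite ?subsetUr // subUset sub1set xS FS.
  by rewrite setU11 (negPf xF).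
split; first by rewrite FS.
move=> X /andP[XS dX] FX; apply/eqP; rewrite eqEsubset FX andbT.
apply/subsetP => x xX; apply: contraT => xF.
have := H x (subsetP XS x xX) xF; rewrite (dissS _ dX) //.
by rewrite subUset sub1set xX.
Qed.

Lemma phi_phis : phi e = phis [set: T].
Proof.
apply: eq_card => F; rewrite !inE; apply/idP/idP.
  case/maxsetP=> dF H; apply/mdsP; split=> // x _ xF; apply/negP => d.
  by have /setP/(_ x) := H _ d (subsetUr _ _); rewrite setU11 (negPf xF).
case/mdsP=> _ dF H; apply/maxsetP; split=> // X dX FX.
apply/eqP; rewrite eqEsubset FX andbT.
apply/subsetP => x xX; apply: contraT => xF.
have := H x (in_setT x) xF; rewrite (dissS _ dX) //.
by rewrite subUset sub1set xX.
Qed.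

Definition nbh (I : {set T}) : {set T} := [set y | [exists x in I, e x y]].

(** The map sending [F] to [F :\: I] is injective on [C]. Its values avoid the neighbours of [I]
    because [F] has no edge from [I] to the rest of [F]. They are maximal in the remaining graph: a
    vertex there has no neighbour in [I], so if it could be added to [F :\: I] it could be added to
    [F]. *)
Lemma class_bound S I D (C : {set {set T}}) :
  I \subset D ->
  (forall F, F \in C -> [/\ mds S F, I \subset F, [disjoint F & D :\: I]
     & forall x y, x \in I -> y \in F -> e x y -> y \in I]) ->
  #|C| <= phis (S :\: (D :|: nbh I)).
Proof.
move=> ID H.
have FI F : F \in C -> F = I :|: (F :\: I).
  move=> /H[_ IF _ _]; apply/setP => x; rewrite !inE.
  by case xI: (x \in I) => //=; rewrite (subsetP IF).
rewrite /phis -(card_in_imset (f := fun F => F :\: I) (D := mem C)); last first.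
  by move=> F G /FI FE /FI GE; rewrite {2}FE {2}GE => ->.
apply: subset_leq_card; apply/subsetP => G /imsetP[F FC ->]; rewrite inE.
have [/mdsP[FS dF mF] IF FD sat] := H F FC.
apply/mdsP; split.
- apply/subsetP => x; rewrite !inE => /andP[xI xF]; rewrite (subsetP FS) // andbT.
  rewrite negb_or; apply/andP; split.
    by have := disjointFr FD xF; rewrite inE xI /= => ->.
  apply/negP => /existsP[y /andP[yI yx]].
  by rewrite (sat y x yI xF yx) in xI.
- by apply: dissS dF; apply: subsetDl.
move=> y; rewrite !inE negb_or => /andP[/andP[yD yN] yS].
have yI: y \notin I by apply: contraNN yD => /(subsetP ID).
rewrite yI /= => yF; apply: contraNN (mF y yS yF) => /dissP d.
have noe x : x \in I -> e x y = false.
  move=> xI; apply/negP => xy; case/negP: yN.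
  by apply/existsP; exists x; rewrite xI.
have outI x z : x \in y |: F -> x \notin I -> z \in y |: F -> e x z -> z \notin I.
  rewrite !inE => /predU1P[->|xF] xI /predU1P[->|zF] xz //.
    by apply/negP => zI; rewrite sym noe in xz.
  by apply: contraNN xI => zI; apply: (sat z x) => //; rewrite sym.
have inI x z : x \in I -> z \in y |: F -> e x z -> z \in I.
  by move=> xI; rewrite !inE => /predU1P[->|zF] xz; [rewrite noe in xz | exact: (sat x)].
apply/dissP => a b c aF bF cF ab ac.
case: (boolP (a \in I)) => aI.
  move/dissP: dF => dF; apply: (dF a) => //; apply: (subsetP IF) => //; exact: (inI a).
have bI := outI a b aF aI bF ab; have cI := outI a c aF aI cF ac.
by apply: (d a) => //; rewrite !inE ?aI ?bI ?cI /=; move: aF bF cF; rewrite !inE.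
Qed.

End Graph.

(** * Partially known neighbourhoods *)

(* Vertices 0, ..., [cord] - 1 are named.  [cnb] lists the known neighbours of each,
   [cno] the pairs known to be non-adjacent, [ccl] the vertices all of whose
   neighbours are known; the adjacency of other pairs is open. *)
Record cfg := Cfg {
  cord : nat;
  cnb : seq (seq nat);
  cno : seq (nat * nat);
  ccl : seq nat }.

(* [B x] splits on the status of [x] in [F]: outside, isolated, or matched with one
   of its neighbours.  [P x] only splits off the cases where [x] is matched. *)
Inductive move := B of nat | P of nat.
Definition vtx m := match m with B x => x | P x => x end.

(* [V ms]: the moves [ms] give a good enough bound.  [E x z c1 c2]: split on whether
   [x] and [z] are adjacent.  [M x c1 c2]: either [x] has no further neighbour, or it
   has one, which gets the next free name.  [K s]: [s] is a component. *)
Inductive cert :=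
  | V of seq move | E of nat & nat & cert & cert | M of nat & cert & cert
  | K of seq nat | F.

Definition nbr c i := nth [::] (cnb c) i.

(** * Evaluation of a list of moves on a partially known graph *)

Section Eval.
Variables (dmin cap : nat) (w : nat -> N).

(** Sufficient reasons only: a closed vertex, a recorded non-edge, a common neighbour (an edge would
    close a triangle), or a vertex that already has the maximum number [cap] of neighbours. *)
Definition notadj c u z :=
  [|| u == z, (u \in ccl c) && (z \notin nbr c u), (z \in ccl c) && (u \notin nbr c z),
      (u, z) \in cno c, (z, u) \in cno c, has (mem (nbr c z)) (nbr c u),
      (cap <= size (nbr c u)) && (z \notin nbr c u)
    | (cap <= size (nbr c z)) && (u \notin nbr c z)].

Variable c : cfg.

(* A lower bound for the number of neighbours of [u] outside [d]. *)
Definition unseen (d : seq nat) u :=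
  if u \in ccl c then 0 else dmin - count (fun z => ~~ notadj c u z) d.

(** A maximum and not a sum, since the unseen neighbours of different vertices may coincide. *)
Definition extra (inn d : seq nat) := foldr maxn 0 (map (unseen d) inn).

(* An outside vertex must have two neighbours in [F], or one that is matched in [F]. *)
Definition infeasible (a q o : seq nat) :=
  has (fun x => [&& x \in ccl c, all (mem (a ++ q ++ o)) (nbr c x),
    ~~ has (mem q) (nbr c x) & count (mem a) (nbr c x) <= 1]) o.

Definition fresh (d s : seq nat) := undup [seq u <- s | u \notin d].

(* The state: [a] isolated in [F], [q] matched in [F], [o] outside [F], [np] not
   matched in [F] (but possibly isolated or outside). *)
Definition branch (g : seq nat -> seq nat -> seq nat -> seq nat -> N) m
    (a q o np : seq nat) : N :=
  let x := vtx m in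
  let d := a ++ q ++ o in
  if (x \in d) || (x \notin ccl c) then g a q o np else
  ((if m is B _ then g (x :: a) q (fresh (x :: d) (nbr c x) ++ o) np + g a q (x :: o) np
    else g a q o (x :: np)) +
   if x \in np then 0 else
   foldr (fun u s => g a (x :: u :: q) (fresh [:: x, u & d] (nbr c x ++ nbr c u) ++ o) np + s) 0
     [seq u <- fresh (x :: d) (nbr c x) | u \notin np])%num.

Fixpoint ev (ms : seq move) (a q o np : seq nat) : N :=
  if infeasible a q o then 0%num else
  let here := w (size (a ++ q ++ o) + extra (a ++ q) (a ++ q ++ o)) in
  if ms is m :: ms' then N.min here (branch (ev ms') m a q o np) else here.

(** The first move must decide something in every case: with nothing decided, the bound would be phi
    of the whole graph, to which the induction hypothesis does not apply. A move [P] would leave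
    such a case. *)
Definition top (ms : seq move) : option N :=
  if ms is B x :: ms' then
    if x \in ccl c then Some (branch (ev ms') (B x) [::] [::] [::] [::]) else None
  else None.

End Eval.

(** * Soundness of the evaluation *)

Section Sound.
Variables (T : finType) (e : rel T).
Hypothesis (sym : symmetric e) (irr : irreflexive e) (tri : triangle_free e).
Variables (S : {set T}) (dmin cap : nat).

Definition nbs x := [set y in S | e x y].

Hypothesis deg_min : forall x, x \in S -> dmin <= #|nbs x|.
Hypothesis deg_max : forall x, x \in S -> #|nbs x| <= cap.

Record real (c : cfg) (p : nat -> T) : Prop := Real {
  real_in : forall i, i < cord c -> p i \in S;
  real_inj : forall i j, i < cord c -> j < cord c -> p i = p j -> i = j;
  real_nbr : forall i j, j \in nbr c i -> [/\ i < cord c, j < cord c & e (p i) (p j)];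
  real_uniq : forall i, uniq (nbr c i);
  real_no : forall i j, (i, j) \in cno c -> [/\ i < cord c, j < cord c & ~~ e (p i) (p j)];
  real_cl : forall i, i \in ccl c -> i < cord c;
  real_closed : forall i y, i \in ccl c -> y \in S -> e (p i) y -> exists2 j, j \in nbr c i & y = p j }.

Variables (c : cfg) (p : nat -> T).
Hypothesis rc : real c p.

Lemma closed_nbr i j : i \in ccl c -> j < cord c -> e (p i) (p j) -> j \in nbr c i.
Proof.
move=> icl jk ij; have [j' j'n pj] := real_closed rc icl (real_in rc jk) ij.
have [_ j'k _] := real_nbr rc j'n.
by rewrite (real_inj rc jk j'k pj).
Qed.

Lemma card_nbr_map (s : seq nat) : uniq s -> {in s, forall i, i < cord c} ->
  #|[set y in map p s]| = size s.
Proof.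
move=> us sk; rewrite cardsE -(size_map p s); apply/card_uniqP.
rewrite map_inj_in_uniq // => i j /sk ik /sk jk; exact: (real_inj rc).
Qed.

(** With [cap] known neighbours, the known ones already exhaust the neighbourhood. *)
Lemma full_nbr i j : i < cord c -> j < cord c -> cap <= size (nbr c i) ->
  e (p i) (p j) -> j \in nbr c i.
Proof.
move=> ik jk capn ij.
have nk : {in nbr c i, forall j, j < cord c} by move=> z /(real_nbr rc)[].
have sub : [set y in map p (nbr c i)] \subset nbs (p i).
  apply/subsetP => y; rewrite !inE => /mapP[z zn ->].
  by have [_ zk ->] := real_nbr rc zn; rewrite (real_in rc zk).
have eqn : [set y in map p (nbr c i)] = nbs (p i).
  apply/eqP; rewrite eqEcard sub card_nbr_map ?(real_uniq rc) //.
  exact: leq_trans (deg_max (real_in rc ik)) capn.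
have : p j \in nbs (p i) by rewrite inE ij (real_in rc jk).
rewrite -eqn inE => /mapP[z zn pz].
by rewrite (real_inj rc jk (nk z zn) pz).
Qed.

Lemma notadjP u z : u < cord c -> z < cord c -> notadj cap c u z -> ~~ e (p u) (p z).
Proof.
move=> uk zk; apply: contraTN => uz.
have zu : e (p z) (p u) by rewrite sym.
rewrite !negb_or; apply/and5P; split.
- by apply: contraTneq uz => ->; rewrite irr.
- by apply/negP => /andP[ucl]; rewrite closed_nbr.
- by apply/negP => /andP[zcl]; rewrite closed_nbr.
- by apply/negP => /(real_no rc)[_ _]; rewrite uz.
apply/and4P; split.
- by apply/negP => /(real_no rc)[_ _]; rewrite zu.
- apply/hasPn => v /(real_nbr rc)[_ _ uv]; apply/negP => /(real_nbr rc)[_ _ zv].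
  by apply: (tri uv _ zu); rewrite sym.
- by apply/negP => /andP[cu]; rewrite full_nbr.
- by apply/negP => /andP[cz]; rewrite full_nbr.
Qed.

Implicit Types (G X : {set T}) (a q o np : seq nat).

(** [ok_pair] does not record who is matched with whom: [class_bound] only needs that no edge inside
    [G] leaves the matched vertices. *)
Record ok a q o np G : Prop := Ok {
  ok_mds : mds e S G;
  ok_alone : forall i, i \in a -> p i \in G /\ forall y, y \in G -> ~~ e (p i) y;
  ok_pair : forall i, i \in q -> p i \in G /\ forall y, y \in G -> e (p i) y -> y \in map p q;
  ok_out : forall i, i \in o -> p i \notin G;
  ok_np : forall i y, i \in np -> p i \in G -> y \in G -> ~~ e (p i) y }.

Definition wf a q o := uniq (a ++ q ++ o) /\ {in a ++ q ++ o, forall i, i < cord c}.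

(** Every neighbour of [x] in [G] is isolated in [G], and there is at most one. Adding [x] creates
    at most one new isolated edge, so [x |: G] is still a dissociation set, against maximality. *)
Lemma infeasibleP a q o np G : infeasible c a q o -> ~ ok a q o np G.
Proof.
move=> /hasP[x xo /and4P[xcl /allP dec /hasPn nq cnt]] H.
have [mG aG qG oG _] := H; have /mdsP[GS dG mxG] := mG.
have xk := real_cl rc xcl; have xG := oG x xo.
have nb y : y \in G -> e (p x) y -> exists j, [/\ j \in nbr c x, j \in a & y = p j].
  move=> yG xy; have [j jn yj] := real_closed rc xcl (subsetP GS y yG) xy.
  exists j; split=> //; have := dec j jn; rewrite inE !mem_cat => /or3P[//|jq|jo].
    by have := nq j jn; rewrite inE jq.
  by move: yG; rewrite yj (negPf (oG j jo)).
have nb1 y z : y \in G -> z \in G -> e (p x) y -> e (p x) z -> y = z.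
  move=> yG zG /(nb y yG)[i [iN ia ->]] /(nb z zG)[j [jN ja ->]].
  congr p; apply/eqP; apply: contraLR cnt => ij; rewrite -ltnNge -size_filter.
  have sub : {subset [:: i; j] <= [seq u <- nbr c x | u \in a]}.
    by move=> u; rewrite !inE mem_filter => /orP[]/eqP->; rewrite ?ia ?ja.
  by rewrite (@uniq_leq_size _ [:: i; j]) //= inE ij.

have far (u v : T) : u \in G -> v \in G -> e u (p x) -> ~~ e u v.
  rewrite sym => uG vG xu; have [j [_ ja ->]] := nb u uG xu.
  by have [_ /(_ v vG)] := aG j ja.
case/negP: (mxG _ (real_in rc xk) xG); apply/dissP => u y z.
rewrite !inE => /predU1P[->|uG] /predU1P[->|yG] /predU1P[->|zG] uy uz //.
- by rewrite irr in uy.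
- by rewrite irr in uz.
- exact: nb1.
- by have := far u z uG zG uy; rewrite uz.
- by have := far u y uG yG uz; rewrite uy.
- by move/dissP: dG => dG; apply: (dG u).
Qed.

(** The factors [sc] and [sc'] let one table [w] of numbers serve all orders in a residue class;
    they become [6 ^ 4 * 6] and [6 ^ q]. *)
Variables (w : nat -> N) (sc sc' : nat).
Hypothesis wP : forall X k, 0 < k -> k <= #|S :&: X| -> sc * phis e (S :\: X) <= sc' * N.to_nat (w k).

(** [class_bound] with [I] the vertices known to lie in [G] and [D] all decided ones. The deleted
    set contains [D] and, for each vertex of [I], its neighbours outside [D]; one such vertex with
    the most guaranteed unseen neighbours accounts for [extra]. *)
Lemma here_bound a q o np (C : {set {set T}}) : wf a q o -> 0 < size (a ++ q ++ o) ->
  (forall G, G \in C -> ok a q o np G) ->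
  sc * #|C| <= sc' * N.to_nat (w (size (a ++ q ++ o) + extra dmin cap c (a ++ q) (a ++ q ++ o))).
Proof.
set d := a ++ q ++ o; move=> [ud dk] d0 H.
pose I := [set y in map p (a ++ q)]; pose D := [set y in map p d].
have ID : I \subset D.
  apply/subsetP => y; rewrite !inE => /mapP[i iI ->]; rewrite map_f //.
  by rewrite /d catA mem_cat iI.
have inD i : i < cord c -> (p i \in D) = (i \in d).
  move=> ik; rewrite inE; apply/mapP/idP => [[j jd pij]|]; last by exists i.
  by rewrite (real_inj rc ik (dk j jd) pij).
have cb : #|C| <= phis e (S :\: (D :|: nbh e I)).
  apply: class_bound ID _ => // G /H[mG aG qG oG _]; split=> //.
  - apply/subsetP => y; rewrite inE => /mapP[i + ->].
    by rewrite mem_cat => /orP[/aG[]|/qG[]].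
  - apply/pred0P => y /=; apply/negP => /andP[yG]; rewrite !inE => /andP[yI /mapP[i iD yi]].
    move: iD; rewrite /d catA mem_cat => /orP[iI|/oG].
      by rewrite yi map_f in yI.
    by rewrite -yi yG.
  move=> x y; rewrite inE => /mapP[i + ->] yG xy; rewrite inE map_cat mem_cat mem_cat.
  case/orP=> [/aG[_ /(_ y yG)]|/qG[_ /(_ y yG xy) ->]]; last by rewrite orbT.
  by rewrite xy.
apply: leq_trans (wP (X := D :|: nbh e I) _ _); first by rewrite leq_mul2l cb orbT.
  by rewrite addn_gt0 d0.
have DS : D \subset S by apply/subsetP => y; rewrite inE => /mapP[i /dk ik ->]; move: (real_in rc ik).
have cD : #|D| = size d by exact: card_nbr_map.
have eD : S :&: (D :|: nbh e I) = D :|: ((S :&: nbh e I) :\: D).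
  apply/setP => y; rewrite !inE; case yD: (y \in map p d) => //=.
    by rewrite andbT; apply: (subsetP DS); rewrite inE.
have disj : [disjoint D & (S :&: nbh e I) :\: D].
  by rewrite -setI_eq0; apply/eqP/setP => y; rewrite !inE; case: (y \in map p d).
rewrite eD cardsU (disjoint_setI0 disj) cards0 subn0 cD leq_add2l.
have bound u : u \in a ++ q -> unseen dmin cap c d u <= #|(S :&: nbh e I) :\: D|.
  move=> uI; rewrite /unseen; case: ifP => // ucl.
  have uD : u \in d by rewrite /d catA mem_cat uI.
  have uk := dk u uD.
  have sub : nbs (p u) \subset [set y in map p [seq z <- d | ~~ notadj cap c u z]] :|: ((S :&: nbh e I) :\: D).
    apply/subsetP => y; rewrite inE => /andP[yS uy].
    case yD: (y \in D); last first.
      move: yD; rewrite inE => yD; apply/setUP; right; rewrite !inE yD yS /=.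
      by apply/existsP; exists (p u); rewrite inE map_f.
    apply/setUP; left; move: yD; rewrite !inE => /mapP[z zd yz]; rewrite yz map_f //.
    rewrite mem_filter zd andbT; apply/negP => /(notadjP uk (dk z zd)).
    by rewrite -yz uy.
  have := leq_trans (deg_min (real_in rc uk)) (subset_leq_card sub).
  rewrite cardsU => le1; rewrite leq_subLR.
  apply: leq_trans le1 _; apply: leq_trans (leq_subr _ _) _.
  rewrite leq_add2r card_nbr_map ?filter_uniq ?size_filter //.
  by move=> z; rewrite mem_filter => /andP[_ /dk].
rewrite /extra; elim: (a ++ q) bound => //= u s IHs bound.
by rewrite geq_max bound ?mem_head //= IHs // => v vs; rewrite bound // inE vs orbT.
Qed.

Lemma fresh_wf a q o a' q' o' f l : wf a q o -> uniq l -> {in l, forall i, i \notin a ++ q ++ o} ->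
  {in l ++ f, forall i, i < cord c} ->
  perm_eq (a' ++ q' ++ o') (fresh (l ++ a ++ q ++ o) f ++ l ++ a ++ q ++ o) -> wf a' q' o'.
Proof.
set d := a ++ q ++ o; move=> [ud dk] ul ld lk pe; split.
  rewrite (perm_uniq pe) cat_uniq undup_uniq cat_uniq ul ud /= andbT.
  apply/andP; split; apply/hasPn => i.
    by move=> il; rewrite mem_undup mem_filter il.
  by move=> id_; apply/negP => /ld; rewrite id_.
move=> i; rewrite (perm_mem pe) mem_cat mem_undup mem_filter mem_cat.
case/orP => [/andP[_ fi]|/orP[li|]]; last exact: dk.
  by apply: lk; rewrite mem_cat fi orbT.
by apply: lk; rewrite mem_cat li.
Qed.

Lemma nbr_lt i j : j \in nbr c i -> j < cord c.
Proof. by case/(real_nbr rc). Qed.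

Lemma branch_sound g m a q o np (C : {set {set T}}) :
  wf a q o -> (0 < size (a ++ q ++ o)) || (if m is B x then x \in ccl c else false) ->
  (forall a q o np (C : {set {set T}}), wf a q o -> 0 < size (a ++ q ++ o) ->
    (forall G, G \in C -> ok a q o np G) -> sc * #|C| <= sc' * N.to_nat (g a q o np)) ->
  (forall G, G \in C -> ok a q o np G) ->
  sc * #|C| <= sc' * N.to_nat (branch c g m a q o np).
Proof.
move=> wfd d0 gP okC; rewrite /branch; set x := vtx m; set d := a ++ q ++ o in wfd d0 *.
have [ud dk] := wfd; case: ifPn => [skip|].
  apply: gP => //; case/orP: d0 => // ; case: m @x skip => //= x + xcl.
  by rewrite xcl orbF; rewrite -/d; case: (d).
rewrite negb_or negbK => /andP[xd xcl]; have xk := real_cl rc xcl.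
pose Cp u := [set G in C | [&& p x \in G, p u \in G & e (p x) (p u)]].
set L := [seq u <- _ | _].
pose base := if m is B _ then [set G in C | (p x \in G) && [forall y in G, ~~ e (p x) y]] :|: [set G in C | p x \notin G]
  else [set G in C | (p x \in G) ==> [forall y in G, ~~ e (p x) y]].
pose prs (L : seq nat) := [set G in C | has (fun u => G \in Cp u) L].
have cover : C \subset base :|: (if x \in np then set0 else prs L).
  apply/subsetP => G GC; have [mG aG qG oG npG] := okC G GC.
  have /mdsP[GS _ _] := mG.
  case xG: (p x \in G); last first.
    by rewrite inE /base; case: (m) => _; rewrite !inE GC xG /= ?orbT.
  case al: [forall y in G, ~~ e (p x) y].
    by rewrite inE /base; case: (m) => _; rewrite !inE GC xG al /= ?orbT.
  move/negbT: al; rewrite negb_forall_in => /exists_inP[y yG]; rewrite negbK => xy.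
  rewrite inE; apply/orP; right; case: ifPn => xnp.
    by have := npG x y xnp xG yG; rewrite xy.
  (* The mate [u] of [x] is an undecided vertex: an isolated one has no neighbour in [G], a matched
     one has its neighbours in [q], an outside one is not in [G]. Nor can it be in [np]. *)
  have [u un yu] := real_closed rc xcl (subsetP GS y yG) xy.
  rewrite inE GC; apply/hasP; exists u; last by rewrite inE GC xG -yu yG xy.
  have ux : e (p u) (p x) by rewrite sym -yu.
  rewrite mem_filter mem_undup mem_filter un andbT; apply/andP; split.
    apply/negP => unp; have := npG u (p x) unp; rewrite -yu yG => /(_ isT xG).
    by rewrite yu ux.
  rewrite inE negb_or; apply/andP; split.
    by apply/eqP => ue; move: ux; rewrite ue irr.
  rewrite !mem_cat; apply/negP => /or3P[ua|uq|uo].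
  - by have [_ /(_ _ xG)] := aG u ua; rewrite ux.
  - have [_ /(_ _ xG ux) /mapP[j jq pxj]] := qG u uq.
    have jd : j \in d by rewrite !mem_cat jq orbT.
    by move: xd; rewrite (real_inj rc xk (dk j jd) pxj) jd.
  - by have := oG u uo; rewrite -yu yG.
have perm1 (b : seq nat) : perm_eq ((x :: a) ++ q ++ b ++ o) (b ++ [:: x] ++ d).
  by apply/permP => z; rewrite /d /= ?count_cat /= ?count_cat /=; lia.
have perm2 (b : seq nat) : perm_eq (a ++ q ++ (x :: b) ++ o) (b ++ [:: x] ++ d).
  by apply/permP => z; rewrite /d /= ?count_cat /= ?count_cat /=; lia.
have perm3 u (b : seq nat) : perm_eq (a ++ (x :: u :: q) ++ b ++ o) (b ++ [:: x; u] ++ d).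
  by apply/permP => z; rewrite /d /= ?count_cat /= ?count_cat /=; lia.
have xl : {in [:: x], forall i, i \notin d} by move=> i; rewrite inE => /eqP->.
have nk u : {in nbr c u, forall i, i < cord c} by move=> i /nbr_lt.
have baseP : sc * #|base| <= sc' * N.to_nat (if m is B _ then g (x :: a) q (fresh (x :: d) (nbr c x) ++ o) np + g a q (x :: o) np
    else g a q o (x :: np))%num.
  rewrite /base; clear cover base; case: m @x d0 L xd xcl xk Cp prs perm1 perm2 perm3 xl => x0 x /= d0 L xd xcl xk Cp prs perm1 perm2 perm3 xl.
    rewrite N2Nat.inj_add mulnDr.
    apply: leq_trans (leq_mul (leqnn sc) (leq_card_setU _ _)) _; rewrite mulnDr; apply: leq_add.
      apply: gP => [||G].
      - apply: (fresh_wf (l := [:: x]) (f := nbr c x) wfd _ xl) => //; last exact: perm1.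
        by move=> i; rewrite inE => /predU1P[->//|/nk].
      - by [].
      rewrite !inE => /and3P[GC xG /forall_inP al]; have [mG aG qG oG npG] := okC G GC; split=> //.
        by move=> i; rewrite inE => /predU1P[->|/aG].
      move=> i; rewrite mem_cat mem_undup mem_filter => /orP[/andP[_ /(real_nbr rc)[_ _ xi]]|/oG//].
      by apply: contraTN xi => /al.
    apply: gP => [||G].
    - apply: (fresh_wf (l := [:: x]) (f := [::]) wfd _ xl) => //; last exact: (perm2 [::]).
      by move=> i; rewrite inE => /eqP->.
    - by rewrite !size_cat /=; lia.
    rewrite !inE => /andP[GC xG]; have [mG aG qG oG npG] := okC G GC; split=> //.
    by move=> i; rewrite inE => /predU1P[->|/oG].
  apply: gP => //; first by rewrite orbF in d0.
  move=> G; rewrite !inE => /andP[GC /implyP al]; have [mG aG qG oG npG] := okC G GC; split=> //.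
  move=> i y; rewrite inE => /predU1P[->|inp] iG yG; last exact: npG.
  by move/forall_inP: (al iG); apply.
apply: leq_trans (leq_mul (leqnn sc) (subset_leq_card cover)) _.
apply: leq_trans (leq_mul (leqnn sc) (leq_card_setU _ _)) _.
rewrite N2Nat.inj_add !mulnDr; apply: leq_add => //.
case: ifPn => xnp; first by rewrite cards0 muln0.
have LP : {in L, forall u, u \notin d /\ u \in nbr c x}.
  move=> u; rewrite mem_filter mem_undup mem_filter inE negb_or => /andP[_ /andP[/andP[_ ->] ->]] //.
elim: (L) LP => [|u L' IHL] LP.
  suff -> : prs [::] = set0 by rewrite cards0 muln0.
  by apply/setP => G; rewrite !inE andbF.
have sub : prs (u :: L') \subset Cp u :|: prs L'.
  by apply/subsetP => G; rewrite !inE /= => /andP[GC]; rewrite !inE GC /=.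
apply: leq_trans (leq_mul (leqnn sc) (subset_leq_card sub)) _.
apply: leq_trans (leq_mul (leqnn sc) (leq_card_setU _ _)) _.
rewrite /= N2Nat.inj_add !mulnDr; apply: leq_add; last first.
  by apply: IHL => v vL; apply: LP; rewrite inE vL orbT.
have [und un] := LP u (mem_head _ _).
have [_ uk xu] := real_nbr rc un.
have neq : x != u by apply: contraTneq xu => <-; rewrite irr.
apply: gP => [||G].
- apply: (fresh_wf (l := [:: x; u]) (f := nbr c x ++ nbr c u) wfd); last exact: perm3.
  + by rewrite /= inE neq.
  + by move=> i; rewrite !inE => /orP[]/eqP->.
  + by move=> i; rewrite !mem_cat !inE -orbA => /or4P[/eqP->|/eqP->|/nk|/nk].
- by rewrite !size_cat /=; lia.
rewrite !inE => /and4P[GC xG uG _]; have [mG aG qG oG npG] := okC G GC.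
have /mdsP[GS /dissP dG _] := mG.
have ux : e (p u) (p x) by rewrite sym.
split=> //.
  move=> i; rewrite !inE => /or3P[/eqP->|/eqP->|iq].
  - by split=> // y yG xy; rewrite (dG _ _ _ xG yG uG xy xu) !inE eqxx orbT.
  - by split=> // y yG uy; rewrite (dG _ _ _ uG yG xG uy ux) !inE eqxx.
  - have [iG H] := qG i iq; split=> // y yG iy.
    by rewrite /= !inE (H y yG iy) !orbT.
move=> i; rewrite mem_cat mem_undup mem_filter => /orP[/andP[]|/oG//].
rewrite !inE !negb_or => /and3P[ix iu _]; rewrite mem_cat => /orP[] /(real_nbr rc)[_ ik ei].
  by apply: contraNN iu => iG; rewrite (real_inj rc ik uk (dG _ _ _ xG iG uG ei xu)).
by apply: contraNN ix => iG; rewrite (real_inj rc ik xk (dG _ _ _ uG iG xG ei ux)).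
Qed.

Lemma ev_sound ms a q o np (C : {set {set T}}) :
  wf a q o -> 0 < size (a ++ q ++ o) -> (forall G, G \in C -> ok a q o np G) ->
  sc * #|C| <= sc' * N.to_nat (ev dmin cap w c ms a q o np).
Proof.
elim: ms a q o np C => [|m ms IH] a q o np C wfd d0 okC /=; case: ifPn => [inf|_].
- suff -> : C = set0 by rewrite cards0 muln0.
  by apply/setP => G; rewrite inE; apply/negP => /okC /(infeasibleP inf).
- exact: here_bound okC.
- suff -> : C = set0 by rewrite cards0 muln0.
  by apply/setP => G; rewrite inE; apply/negP => /okC /(infeasibleP inf).
set u := w _; set v := branch _ _ _ _ _ _ _.
case: (N.min_spec u v) => -[_ ->].
  exact: here_bound okC.
by apply: branch_sound okC => //; rewrite d0.
Qed.

Lemma top_sound ms v : top dmin cap w c ms = Some v -> sc * phis e S <= sc' * N.to_nat v.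
Proof.
rewrite /top; case: ms => // -[] // x ms; case: ifP => // xcl [<-].
apply: branch_sound; first by split.
- by rewrite /= xcl.
- by move=> *; apply: ev_sound.
- by move=> G; rewrite inE.
Qed.

End Sound.

(** * Exploring a neighbourhood *)

(* P3, C4, K_{2,3} and K_{3,3} for m = 3, 4, 5, 6. *)
Definition base_rel m i j :=
  if m == 3 then (i + j == 1) || (i + j == 3) else
  if m == 4 then odd i != odd j else
  if m == 5 then (i < 2) != (j < 2) else (i < 3) != (j < 3).

Definition upd (nb : seq (seq nat)) i v := set_nth [::] nb i v.
Definition close c x := Cfg (cord c) (cnb c) (cno c) (x :: ccl c).
Definition addedge c x z :=
  Cfg (cord c) (upd (upd (cnb c) x (z :: nbr c x)) z (x :: nbr c z)) (cno c) (ccl c).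
Definition noedge c x z := Cfg (cord c) (cnb c) ((x, z) :: cno c) (ccl c).
Definition newv c x :=
  Cfg (cord c).+1 (upd (upd (cnb c) x (cord c :: nbr c x)) (cord c) [:: x]) (cno c) (ccl c).

Definition is_component (c : cfg) (s : seq nat) :=
  let m := size s in
  [&& uniq s, all (mem (ccl c)) s, all (fun i => all (mem s) (nbr c i)) s
    & all (fun i => all (fun j => (nth 0 s j \in nbr c (nth 0 s i)) == base_rel m i j) (iota 0 m))
          (iota 0 m)].

(** Before an [M] step, adjacency of [x] to each named vertex must be settled; a further neighbour
    is then a genuinely new vertex. The degree bounds rule out closing [x] too early or extending it
    too far, and the certificate of such a branch is not inspected. The comparison in [V] is strict,
    so equality can only come from [K]. *)
Fixpoint check (dmin cap : nat) (w : nat -> N) (goal : N) (ks : seq nat) (c : cfg) (ct : cert) : bool :=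
  match ct with
  | V ms => if top dmin cap w c ms is Some v then N.ltb v goal else false
  | E x z c1 c2 => [&& x < cord c, z < cord c, x != z, z \notin nbr c x, x \notin nbr c z,
      check dmin cap w goal ks (addedge c x z) c1 & check dmin cap w goal ks (noedge c x z) c2]
  | M x c1 c2 => [&& x < cord c,
      all (fun z => (z \in nbr c x) || notadj cap c x z) (iota 0 (cord c)),
      (size (nbr c x) < dmin) || check dmin cap w goal ks (close c x) c1
    & (cap <= size (nbr c x)) || check dmin cap w goal ks (newv c x) c2]
  | K s => (size s \in ks) && is_component c s
  | F => false
  end.

(** * Soundness of certificates *)

Section Check.
Variables (T : finType) (e : rel T).
Hypothesis (sym : symmetric e) (irr : irreflexive e) (tri : triangle_free e).
Variables (S : {set T}) (dmin cap : nat).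
Hypothesis deg_min : forall x, x \in S -> dmin <= #|nbs e S x|.
Hypothesis deg_max : forall x, x \in S -> #|nbs e S x| <= cap.
Variables (w : nat -> N) (sc sc' : nat).
Hypothesis wP : forall X k, 0 < k -> k <= #|S :&: X| -> sc * phis e (S :\: X) <= sc' * N.to_nat (w k).

Record component m (q : nat -> T) : Prop := Component {
  component_in : forall i, i < m -> q i \in S;
  component_inj : forall i j, i < m -> j < m -> q i = q j -> i = j;
  component_e : forall i j, i < m -> j < m -> e (q i) (q j) = base_rel m i j;
  component_closed : forall i y, i < m -> y \in S -> e (q i) y -> exists2 j, j < m & y = q j }.

Lemma nbr_upd2 c x z vx vz k no cl i :
  nbr (Cfg k (upd (upd (cnb c) x vx) z vz) no cl) i =
  if i == z then vz else if i == x then vx else nbr c i.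
Proof.
rewrite /nbr /upd /= nth_set_nth /=; case: (i == z) => //.
by rewrite nth_set_nth.
Qed.

Lemma real_addedge c p x z : real e S c p -> x < cord c -> z < cord c -> x != z ->
  z \notin nbr c x -> x \notin nbr c z -> e (p x) (p z) -> real e S (addedge c x z) p.
Proof.
move=> rc xk zk xz zx_ xz_ exz; have [R1 R2 R3 R4 R5 R6 R7] := rc; split=> //=.
- move=> i j; rewrite nbr_upd2; case: eqP => [->|_].
    by rewrite inE => /predU1P[->|/R3//]; rewrite sym.
  by case: eqP => [->|_]; [rewrite inE => /predU1P[->|/R3//] | exact: R3].
- by move=> i; rewrite nbr_upd2; case: eqP => _ /=; [rewrite xz_ R4|case: eqP => _ /=; rewrite ?zx_ R4].
- move=> i y /R7 H yS /(H y yS)[j jn ->]; exists j => //.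
  rewrite nbr_upd2; case: eqP => [iz|_]; first by rewrite inE -iz jn orbT.
  by case: eqP => [ix|_] //; rewrite inE -ix jn orbT.
Qed.

Lemma real_noedge c p x z : real e S c p -> x < cord c -> z < cord c -> ~~ e (p x) (p z) -> real e S (noedge c x z) p.
Proof.
move=> [R1 R2 R3 R4 R5 R6 R7] xk zk nxz; split=> //= i j.
by rewrite inE => /predU1P[[-> ->]//|/R5].
Qed.

Lemma real_newv c p x y : real e S c p -> x < cord c -> y \in S -> e (p x) y ->
  (forall i, i < cord c -> p i <> y) ->
  real e S (newv c x) (fun i => if i == cord c then y else p i).
Proof.
move=> [R1 R2 R3 R4 R5 R6 R7] xk yS xy new.
have ltE i : i < cord c -> (i == cord c) = false by move=> ik; apply/eqP; lia.
have kn i : cord c \notin nbr c i by apply/negP => /R3[_]; rewrite ltnn.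
split=> /=.
- by move=> i ik; case: eqP => // ne; apply: R1; lia.
- move=> i j ik jk; case: (eqVneq i (cord c)) => [->|ni]; case: (eqVneq j (cord c)) => [->|nj] //.
  + by move=> yj; case: (new j); [lia|].
  + by move=> yi; case: (new i); [lia|].
  + by move=> ?; apply: R2 => //; lia.
- move=> i j; rewrite nbr_upd2; case: (eqVneq i (cord c)) => [->|ni].
    by rewrite inE => /eqP->; rewrite (ltE _ xk) sym; split=> //; lia.
  case: (eqVneq i x) => [->|_]; last first.
    by move=> /R3[ik jk ij]; rewrite (ltE _ jk); split=> //; lia.
  rewrite inE => /predU1P[->|/R3[_ jk xj]]; first by rewrite eqxx; split=> //; lia.
  by rewrite (ltE _ jk); split=> //; lia.
- move=> i; rewrite nbr_upd2; case: eqP => // _; case: eqP => // _.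
  by rewrite /= kn R4.
- by move=> i j /R5[ik jk ij]; rewrite !ltE //; split=> //; lia.
- by move=> i /R6; lia.
move=> i z ic; have ik := R6 i ic; rewrite ltE // => zS iz.
have [j jn ->] := R7 i z ic zS iz; have [_ jk _] := R3 _ _ jn.
exists j; last by rewrite ltE.
by rewrite nbr_upd2 ltE //; case: eqP => [ix|_] //; rewrite inE -ix jn orbT.
Qed.

Lemma real_close c p x : real e S c p -> x < cord c ->
  (forall y, y \in S -> e (p x) y -> exists2 j, j \in nbr c x & y = p j) ->
  real e S (close c x) p.
Proof.
move=> [R1 R2 R3 R4 R5 R6 R7] xk H; split=> //=.
  by move=> i; rewrite inE => /predU1P[->|/R6].
by move=> i y; rewrite inE => /predU1P[->|]; [exact: H|exact: R7].
Qed.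

Lemma is_component_sound c p s : real e S c p -> is_component c s -> component (size s) (fun i => p (nth 0 s i)).
Proof.
move=> rc /and4P[us /allP scl /allP snb /allP sh]; have [R1 R2 R3 R4 R5 R6 R7] := rc.
have nthk i : i < size s -> nth 0 s i < cord c by move=> im; apply/R6/scl/mem_nth.
split.
- by move=> i /nthk/R1.
- by move=> i j im jm /(R2 _ _ (nthk i im) (nthk j jm)) /eqP; rewrite nth_uniq // => /eqP.
- move=> i j im jm.
  have iI k : k < size s -> k \in iota 0 (size s) by rewrite mem_iota.
  have /allP/(_ j (iI j jm))/eqP <- := sh i (iI i im); apply/idP/idP => [|/R3[]//].
  by apply: (closed_nbr rc); [exact/scl/mem_nth|exact: nthk].
move=> i y im yS iy; have si := mem_nth 0 im.
have [j jn ->] := R7 _ y (scl _ si) yS iy.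
have js : j \in s by have /allP/(_ j jn) := snb _ si.
by exists (index j s); rewrite ?index_mem ?nth_index.
Qed.

Lemma check_sound goal ks ct c p : real e S c p -> check dmin cap w goal ks c ct ->
  (exists2 v, sc * phis e S <= sc' * N.to_nat v & N.ltb v goal) \/
  (exists m q, m \in ks /\ component m q).
Proof.
elim: ct c p => [ms|x z c1 IH1 c2 IH2|x c1 IH1 c2 IH2|s|] c p rc //=.
- case topE: (top _ _ _ _ _) => [v|] // vw; left; exists v => //.
  exact: (top_sound sym irr tri deg_min deg_max rc wP topE).
- case/and5P=> xk zk xz zx_ /and3P[xz_ ch1 ch2].
  case: (boolP (e (p x) (p z))) => exz.
    by apply: (IH1 _ p) ch1; apply: real_addedge.
  by apply: (IH2 _ p) ch2; apply: real_noedge.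
- case/and4P=> xk /allP dec ch1 ch2.
  have xS := real_in rc xk.
  pose A := [set y in map p (nbr c x)].
  have nk : {in nbr c x, forall j, j < cord c} by move=> z /(real_nbr rc)[].
  have cA : #|A| = size (nbr c x) by rewrite (card_nbr_map rc) ?(real_uniq rc).
  have AN : A \subset nbs e S (p x).
    apply/subsetP => y; rewrite !inE => /mapP[z zn ->].
    by have [_ zk ->] := real_nbr rc zn; rewrite (real_in rc zk).
  case: (boolP (nbs e S (p x) \subset A)) => [/subsetP NA|/subsetPn[y]].
    have eA : A = nbs e S (p x) by apply/eqP; rewrite eqEsubset AN; apply/subsetP.
    case/orP: ch1 => [|ch1].
      by rewrite ltnNge -cA eA deg_min.
    apply: (IH1 _ p) ch1; apply: real_close => // y yS xy.
    by have := NA y; rewrite !inE yS xy => /(_ isT)/mapP.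
  rewrite !inE => /andP[yS xy] yA.
  case/orP: ch2 => [capn|ch2].
    have := deg_max xS; rewrite leqNgt; case/negP.
    rewrite -cA in capn; apply: leq_ltn_trans capn _; apply: proper_card.
    by apply/properP; split=> //; exists y; rewrite !inE ?yS.
  apply: (IH2 _ _) ch2; apply: (real_newv rc xk yS xy) => i ik piy.
  have := dec i; rewrite mem_iota ik => /(_ isT)/orP[ix|].
    by case/negP: yA; rewrite -piy map_f.
  by move/(notadjP sym irr tri deg_max rc xk ik); rewrite piy xy.
case/andP=> sk cok; right; exists (size s), (fun i => p (nth 0 s i)).
split=> //; exact: is_component_sound rc cok.
Qed.

End Check.

(** * Components *)

Section Product.
Variables (T : finType) (e : rel T).
Hypothesis (sym : symmetric e).
Implicit Types (S Z F : {set T}).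

(** No edge joins [Z] to the rest, so being a dissociation set and being maximal can both be tested
    on the two sides separately; [F] corresponds to the pair of [F :&: Z] and [F :\: Z]. *)
Lemma phis_disjoint S Z : Z \subset S ->
  (forall x y, x \in Z -> y \in S -> e x y -> y \in Z) ->
  phis e S = phis e Z * phis e (S :\: Z).
Proof.
move=> ZS cl.
have dU (A B : {set T}) : A \subset Z -> B \subset S :\: Z ->
    dissociation e (A :|: B) = dissociation e A && dissociation e B.
  move=> AZ BZ; apply/idP/andP => [d|[/dissP dA /dissP dB]].
    by split; apply: dissS d; rewrite ?subsetUl ?subsetUr.
  have no a b : a \in A -> b \in B -> ~~ e a b.
    move=> /(subsetP AZ) aZ /(subsetP BZ); rewrite inE => /andP[bZ bS].
    by apply: contraNN bZ; apply: cl.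
  apply/dissP => x y z; rewrite !inE => /orP[xA|xB] /orP[yA|yB] /orP[zA|zB] xy xz.
  - exact: (dA x).
  - by move: (no x z xA zB); rewrite xz.
  - by move: (no x y xA yB); rewrite xy.
  - by move: (no x y xA yB); rewrite xy.
  - by move: (no y x yA xB); rewrite sym xy.
  - by move: (no y x yA xB); rewrite sym xy.
  - by move: (no z x zA xB); rewrite sym xz.
  - exact: (dB x).
have split1 (A B : {set T}) : A \subset Z -> B \subset S :\: Z ->
    mds e S (A :|: B) = mds e Z A && mds e (S :\: Z) B.
  move=> AZ BZ; have BS := subset_trans BZ (subsetDl _ _).
  have xB x : x \in Z -> x \notin B.
    by move=> xZ; apply/negP => /(subsetP BZ); rewrite inE xZ.
  have xA x : x \in S :\: Z -> x \notin A.
    by rewrite inE => /andP[xZ _]; apply: contraNN xZ => /(subsetP AZ).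
  apply/mdsP/andP => [[_ d m]|[/mdsP[_ dA mA] /mdsP[_ dB mB]]].
    have /andP[dA dB] : dissociation e A && dissociation e B by rewrite -dU.
    split; apply/mdsP; split=> // x.
      move=> xZ xnA; have := m x (subsetP ZS x xZ).
      rewrite inE negb_or xnA xB // => /(_ isT).
      by rewrite setUA dU ?subUset ?sub1set ?xZ // dB andbT.
    move=> xSZ xnB; have := m x; rewrite inE negb_or xnB xA //.
    have xS : x \in S by move: xSZ; rewrite inE => /andP[].
    move=> /(_ xS isT); rewrite setUCA dU // ?subUset ?sub1set ?xSZ //.
    by rewrite dA.
  split; first by rewrite subUset BS (subset_trans AZ ZS).
    by rewrite dU // dA dB.
  move=> x xS; rewrite inE negb_or => /andP[xnA xnB].
  case: (boolP (x \in Z)) => xZ.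
    by rewrite setUA dU ?subUset ?sub1set ?xZ // negb_and mA.
  have xSZ : x \in S :\: Z by rewrite inE xZ.
  by rewrite setUCA dU // ?subUset ?sub1set ?xSZ // negb_and mB // orbT.
rewrite /phis -cardsX.
have inj : {in setX [set F | mds e Z F] [set F | mds e (S :\: Z) F] &,
    injective (fun G : {set T} * {set T} => G.1 :|: G.2)}.
  move=> [A B] [A' B']; rewrite !inE /= => /andP[/mdsP[AZ _ _] /mdsP[BZ _ _]].
  move=> /andP[/mdsP[AZ' _ _] /mdsP[BZ' _ _]] /setP eq.
  have tr x : (x \in A) = (x \in A') /\ (x \in B) = (x \in B').
    have := eq x; rewrite !inE.
    have := subsetP AZ x; have := subsetP AZ' x; have := subsetP BZ x; have := subsetP BZ' x.
    rewrite !inE; case: (x \in A); case: (x \in A'); case: (x \in B); case: (x \in B') => //=;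
      case: (x \in Z) => //=; case: (x \in S) => //= h1 h2 h3 h4; split => //;
      by [have := h1 isT | have := h2 isT | have := h3 isT | have := h4 isT].
  by congr (_, _); apply/setP => x; have [] := tr x.
rewrite -(card_in_imset inj); apply: eq_card => F; rewrite inE.
apply/idP/imsetP => [mF|[[A B]]]; last first.
  rewrite !inE /= => /andP[mA mB] ->; have /mdsP[AZ _ _] := mA; have /mdsP[BZ _ _] := mB.
  by rewrite split1 // mA mB.
have /mdsP[FS _ _] := mF.
have eF : F = (F :&: Z) :|: (F :\: Z) by rewrite setID.
exists (F :&: Z, F :\: Z); last by rewrite /= -eF.
by rewrite !inE /= -split1 -?eF // ?subsetIr // setSD.
Qed.

End Product.

(** * Counting in the base components by enumeration of subsets *)

Fixpoint subs (s : seq nat) : seq (seq nat) :=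
  if s is i :: s' then subs s' ++ [seq i :: l | l <- subs s'] else [:: [::]].

Definition dissb m (l : seq nat) :=
  all (fun i => all (fun j => all (fun k => base_rel m i j && base_rel m i k ==> (j == k)) l) l) l.

Definition mdsb m l :=
  dissb m l && all (fun j => (j \in l) || ~~ dissb m (j :: l)) (iota 0 m).

Lemma mem_subs (a : pred nat) s : filter a s \in subs s.
Proof.
elim: s => //= i s IH; rewrite mem_cat; case: (a i); last by rewrite IH.
by rewrite map_f ?orbT.
Qed.

Section CompPhi.
Variables (T : finType) (e : rel T) (m : nat) (q : nat -> T).
Hypothesis q_inj : forall i j, i < m -> j < m -> q i = q j -> i = j.
Hypothesis q_e : forall i j, i < m -> j < m -> e (q i) (q j) = base_rel m i j.

Definition toset (l : seq nat) : {set T} := [set y in map q l].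

Lemma toset_in l j : {in l, forall i, i < m} -> j < m -> (q j \in toset l) = (j \in l).
Proof.
move=> lm jm; rewrite inE; apply/mapP/idP => [[i il /q_inj ->//]|]; last by exists j.
exact: lm.
Qed.

Lemma diss_toset l : {in l, forall i, i < m} -> dissociation e (toset l) = dissb m l.
Proof.
move=> lm; apply/dissP/idP => [d|].
  apply/allP => i il; apply/allP => j jl; apply/allP => k kl.
  apply/implyP => /andP[ij ik]; apply/eqP/q_inj; [exact: lm..|].
  by apply: (d (q i)); rewrite ?toset_in ?q_e //; apply: lm.
move=> /allP d x y z; rewrite !inE => /mapP[i il ->] /mapP[j jl ->] /mapP[k kl ->].
rewrite !q_e ?lm // => ij ik.
have /allP/(_ j jl)/allP/(_ k kl)/implyP := d i il.
by rewrite ij ik => /(_ isT)/eqP->.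
Qed.

(** These three facts about the enumeration are hypotheses because for each of the few values of [m]
    they hold by evaluation. Together they say that the lists represent distinct subsets of the
    vertices. *)
Hypothesis subs_lt : all (all (fun i => i < m)) (subs (iota 0 m)).
Hypothesis subs_canon : all (fun l : seq nat => l == [seq i <- iota 0 m | i \in l]) (subs (iota 0 m)).
Hypothesis subs_uniq : uniq (subs (iota 0 m)).

Lemma phis_toset : phis e (toset (iota 0 m)) = count (mdsb m) (subs (iota 0 m)).
Proof.
have lt l : l \in subs (iota 0 m) -> {in l, forall i, i < m}.
  by move=> ls; apply/allP; exact: (allP subs_lt).
have im : {in iota 0 m, forall i, i < m} by move=> i; rewrite mem_iota.
have mE l : l \in subs (iota 0 m) -> mds e (toset (iota 0 m)) (toset l) = mdsb m l.
  move=> ls; have lm := lt l ls.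
  apply/mdsP/andP => [[_ d mx]|[d mx]].
    split; first by rewrite -diss_toset.
    apply/allP => j; rewrite mem_iota => jm; case: (boolP (j \in l)) => //= jl.
    rewrite -diss_toset; last by move=> i; rewrite inE => /predU1P[->|/lm].
    have := mx (q j); rewrite !toset_in ?mem_iota // => /(_ jm jl).
    by congr (~~ dissociation e _); apply/setP => y; rewrite !inE.
  split; rewrite ?diss_toset //.
    by apply/subsetP => y; rewrite !inE => /mapP[i il ->]; rewrite map_f // mem_iota lm.
  move=> x; rewrite inE => /mapP[j]; rewrite mem_iota => jm ->; rewrite toset_in // => jl.
  have := allP mx j; rewrite mem_iota (negPf jl) => /(_ jm) /=.
  rewrite -diss_toset; last by move=> i; rewrite inE => /predU1P[->|/lm].
  by congr (~~ dissociation e _); apply/setP => y; rewrite !inE.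
rewrite -size_filter -(size_map toset).
have us : uniq [seq toset l | l <- subs (iota 0 m) & mdsb m l].
  rewrite map_inj_in_uniq ?filter_uniq // => l l'.
  rewrite !mem_filter => /andP[_ ls] /andP[_ ls'] eq.
  rewrite (eqP (allP subs_canon l ls)) (eqP (allP subs_canon l' ls')).
  apply: eq_in_filter => i; rewrite mem_iota => ilt.
  by rewrite -(toset_in (lt l ls) ilt) eq (toset_in (lt l' ls') ilt).
rewrite -(card_uniqP us); apply: eq_card => F; rewrite inE.
apply/idP/mapP => [mF|[l]]; last first.
  by rewrite mem_filter => /andP[ml ls] ->; rewrite mE.
pose l := [seq i <- iota 0 m | q i \in F].
have ls : l \in subs (iota 0 m) by apply: mem_subs.
have eF : F = toset l.
  have /mdsP[/subsetP FS _ _] := mF.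
  apply/setP => y; apply/idP/idP => [yF|].
    have := FS y yF; rewrite inE => /mapP[i im_ yi].
    by rewrite inE yi map_f // mem_filter -yi yF.
  by rewrite inE => /mapP[i]; rewrite mem_filter => /andP[iF _] ->.
by exists l => //; rewrite mem_filter ls -mE // -eF mF.
Qed.

End CompPhi.

(** * Certificates *)

(* Six times the maximum of phi on n vertices (only an upper bound for n = 1, 2);
   the factor makes the values for n < 4 integers. *)
Definition f n := 6 ^ (n %/ 4) * nth 0 [:: 6; 8; 11; 18] (n %% 4).

Definition weights : seq N :=
  [:: 6; 8; 11; 18; 36; 48; 66; 108; 216; 288; 396; 648; 1296; 1728; 2376; 3888;
      7776; 10368; 14256; 23328]%num.

(* [f (n - k)] for [n = 4 q + r], up to the factor [6 ^ (q - 4)];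
   an upper bound when [16 + r - k] is truncated. *)
Definition weight r k : N := nth 0%num weights (16 + r - k).

(* 23/24 of [weight r 0] for r = 0, 1 and [weight r 0] for r = 2, 3. *)
Definition goal r : N := nth 0%num [:: 7452; 9936; 14256; 23328]%num r.

(** Besides C4, only the component whose removal leaves an order divisible by 4, as in the extremal
    graph of that residue. *)
Definition comps r := nth [::] [:: [:: 4]; [:: 4; 5]; [:: 4; 6]; [:: 4; 3]] r.

(** Every exploration starts from vertex 0 with its complete neighbourhood 1, ..., d. *)
Definition star d := Cfg d.+1 (iota 1 d :: nseq d [:: 0]) [::] [:: 0].

(** The choice between isolated and outside for members of [l] is delayed until the cases where they
    are matched have been split off. When [x] is outside and [l] is its neighbourhood, [infeasible]
    then discards the cases with no matched and at most one isolated member. *)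
Definition block x l := B x :: map P l ++ map B l.

(* [cert_r_d] is for n = r mod 4 and a first vertex of degree d.  The certificates
   were found by a heuristic search outside Rocq. *)
Definition cert_0_1 := M 1 (V [:: B 0]) (M 1 (V [:: B 1]) (M 1 (V [:: B 0; B 1]) (V [:: B 0]))).

Definition cert_0_2 := M 1 F (M 1 (E 2 3 (M 2 (M 3 (K [:: 0; 1; 3; 2]) (V (block 0 [:: 1; 2])))
  (M 2 (V (block 0 [:: 1; 2])) (V [:: B 0]))) (M 2 F (M 2 (E 3 4 (V (block 0 [:: 1; 2])) (V
  (block 0 [:: 1; 2]))) (M 2 (V (block 0 [:: 1; 2])) (V [:: B 0]))))) (M 1 (V [:: B 1]) (V [:: B
  0]))).

Definition cert_1_1 := M 1 (V [:: B 0; B 1]) (M 1 (V [:: B 0; B 1]) (M 1 (V [:: B 0; B 1]) (M 1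
  (V [:: B 0; B 1]) (M 1 (V [:: B 0; B 1]) (M 1 (V [:: B 0; B 1]) (M 1 (V [:: B 1]) F)))))).

Definition cert_1_2 := M 1 F (M 1 (E 2 3 (M 2 (M 3 (K [:: 0; 1; 3; 2]) (M 3 (V (block 0 [:: 1;
  2] ++ [:: B 3])) (V (block 0 [:: 1; 2])))) (M 2 (M 3 (V ([:: B 0] ++ block 3 [:: 1; 2])) (V
  (block 0 [:: 1; 2]))) (M 2 (V (block 0 [:: 1; 2])) (M 2 (V (block 0 [:: 1; 2])) (M 2 (V (block
  0 [:: 1; 2])) (M 2 (V (block 0 [:: 1; 2])) F)))))) (M 2 F (M 2 (E 3 4 (V (block 0 [:: 1; 2]))
  (M 3 F (M 3 (V (block 0 [:: 1; 2] ++ [:: B 3])) (V [:: B 2; B 1; B 0])))) (M 2 (E 3 4 (V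
  (block 0 [:: 1; 2])) (E 3 5 (V (block 0 [:: 1; 2])) (V (block 0 [:: 1; 2])))) (M 2 (V (block 0
  [:: 1; 2])) (M 2 (V (block 0 [:: 1; 2])) (M 2 (V (block 0 [:: 1; 2])) (M 2 (V (block 0 [:: 1;
  2])) F)))))))) (M 1 (E 2 3 (E 2 4 (M 2 (M 3 (M 4 (K [:: 1; 2; 0; 3; 4]) (V ([:: B 0] ++ block
  3 [:: 1; 2]))) (M 3 (E 4 5 (V (block 0 [:: 1; 2])) (M 4 (V (block 0 [:: 1; 2] ++ [:: B 4])) (V
  (block 0 [:: 1; 2])))) (V (block 0 [:: 1; 2])))) (M 2 (V (block 0 [:: 1; 2])) (M 2 (V (block 0
  [:: 1; 2])) (M 2 (V (block 0 [:: 1; 2])) (M 2 (V (block 0 [:: 1; 2])) F))))) (M 2 (M 3 (V ([::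
  B 0] ++ block 3 [:: 1; 2])) (V (block 0 [:: 1; 2]))) (M 2 (M 3 (E 4 5 (V (block 0 [:: 1; 2]))
  (V ([:: B 0] ++ block 3 [:: 1; 2]))) (V (block 0 [:: 1; 2]))) (M 2 (V (block 0 [:: 1; 2])) (M
  2 (V (block 0 [:: 1; 2])) (M 2 (V (block 0 [:: 1; 2])) (M 2 (V (block 0 [:: 1; 2])) F)))))))
  (E 2 4 (M 2 (M 4 (V ([:: B 0] ++ block 4 [:: 1; 2])) (V (block 0 [:: 1; 2]))) (M 2 (M 4 (E 3 5
  (V (block 0 [:: 1; 2])) (V ([:: B 0] ++ block 4 [:: 1; 2]))) (V (block 0 [:: 1; 2]))) (M 2 (V
  (block 0 [:: 1; 2])) (M 2 (V (block 0 [:: 1; 2])) (M 2 (V (block 0 [:: 1; 2])) (M 2 (V (block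
  0 [:: 1; 2])) F)))))) (M 2 F (M 2 (E 5 3 (V (block 0 [:: 1; 2])) (E 5 4 (V (block 0 [:: 1;
  2])) (V [:: B 0; B 2; B 1]))) (M 2 (E 5 3 (E 5 4 (V (block 0 [:: 1; 2])) (M 5 (V (block 0 [::
  1; 2])) (V (block 0 [:: 1; 2])))) (E 5 4 (M 5 (V (block 0 [:: 1; 2])) (V (block 0 [:: 1; 2])))
  (M 5 F (M 5 (E 6 3 (V (block 0 [:: 1; 2] ++ [:: B 5])) (E 6 4 (V (block 0 [:: 1; 2] ++ [:: B
  5])) (V (block 0 [:: 1; 2])))) (V (block 0 [:: 1; 2])))))) (M 2 (V (block 0 [:: 1; 2])) (M 2
  (V (block 0 [:: 1; 2])) (M 2 (V (block 0 [:: 1; 2])) (M 2 (V (block 0 [:: 1; 2])) F)))))))))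
  (M 1 (E 2 3 (E 2 4 (E 2 5 (M 2 (V (block 0 [:: 1; 2])) (M 2 (V (block 0 [:: 1; 2])) (M 2 (V
  (block 0 [:: 1; 2])) (M 2 (V (block 0 [:: 1; 2])) F)))) (M 2 (V (block 0 [:: 1; 2])) (M 2 (V
  (block 0 [:: 1; 2])) (M 2 (V (block 0 [:: 1; 2])) (M 2 (V (block 0 [:: 1; 2])) (M 2 (V (block
  0 [:: 1; 2])) F)))))) (E 2 5 (M 2 (V (block 0 [:: 1; 2])) (M 2 (V (block 0 [:: 1; 2])) (M 2 (V
  (block 0 [:: 1; 2])) (M 2 (V (block 0 [:: 1; 2])) (M 2 (V (block 0 [:: 1; 2])) F))))) (M 2 (V
  (block 0 [:: 1; 2])) (M 2 (V (block 0 [:: 1; 2])) (M 2 (V (block 0 [:: 1; 2])) (M 2 (V (block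
  0 [:: 1; 2])) (M 2 (V (block 0 [:: 1; 2])) (M 2 (V (block 0 [:: 1; 2])) F)))))))) (E 2 4 (E 2
  5 (M 2 (V (block 0 [:: 1; 2])) (M 2 (V (block 0 [:: 1; 2])) (M 2 (V (block 0 [:: 1; 2])) (M 2
  (V (block 0 [:: 1; 2])) (M 2 (V (block 0 [:: 1; 2])) F))))) (M 2 (V (block 0 [:: 1; 2])) (M 2
  (V (block 0 [:: 1; 2])) (M 2 (V (block 0 [:: 1; 2])) (M 2 (V (block 0 [:: 1; 2])) (M 2 (V
  (block 0 [:: 1; 2])) (M 2 (V (block 0 [:: 1; 2])) F))))))) (E 2 5 (M 2 (V (block 0 [:: 1; 2]))
  (M 2 (V (block 0 [:: 1; 2])) (M 2 (V (block 0 [:: 1; 2])) (M 2 (V (block 0 [:: 1; 2])) (M 2 (V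
  (block 0 [:: 1; 2])) (M 2 (V (block 0 [:: 1; 2])) F)))))) (M 2 F (M 2 (V (block 0 [:: 1; 2]))
  (M 2 (V (block 0 [:: 1; 2])) (M 2 (V (block 0 [:: 1; 2])) (M 2 (V (block 0 [:: 1; 2])) (M 2 (V
  (block 0 [:: 1; 2])) (M 2 (V (block 0 [:: 1; 2])) F)))))))))) (M 1 (E 2 3 (E 2 4 (E 2 5 (V [::
  B 0; B 1]) (E 2 6 (V [:: B 0; B 1]) (M 2 (V (block 0 [:: 1; 2])) (V [:: B 0; B 1])))) (E 2 5
  (E 2 6 (V [:: B 0; B 1]) (M 2 (V (block 0 [:: 1; 2])) (V [:: B 0; B 1]))) (E 2 6 (M 2 (V
  (block 0 [:: 1; 2])) (V [:: B 0; B 1])) (M 2 (V (block 0 [:: 1; 2])) (M 2 (V (block 0 [:: 1;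
  2])) (V [:: B 0; B 1])))))) (E 2 4 (E 2 5 (E 2 6 (V [:: B 0; B 1]) (M 2 (V (block 0 [:: 1;
  2])) (V [:: B 0; B 1]))) (E 2 6 (M 2 (V (block 0 [:: 1; 2])) (V [:: B 0; B 1])) (M 2 (V (block
  0 [:: 1; 2])) (M 2 (V (block 0 [:: 1; 2])) (V [:: B 0; B 1]))))) (E 2 5 (E 2 6 (M 2 (V (block
  0 [:: 1; 2])) (V [:: B 0; B 1])) (M 2 (V (block 0 [:: 1; 2])) (M 2 (V (block 0 [:: 1; 2])) (V
  [:: B 0; B 1])))) (E 2 6 (M 2 (V (block 0 [:: 1; 2])) (M 2 (V (block 0 [:: 1; 2])) (V [:: B 0;
  B 1]))) (M 2 F (M 2 (V (block 0 [:: 1; 2])) (M 2 (V (block 0 [:: 1; 2])) (V [:: B 0; B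
  1])))))))) (M 1 (V [:: B 1]) (M 1 (V [:: B 1]) F)))))).

Definition cert_1_3 := M 1 F (M 1 F (M 1 (E 2 4 (E 2 5 (M 2 (V [:: B 1; B 2]) F) (M 2 F (M 2 (E
  5 3 (E 5 6 (V [:: B 1; B 2]) (M 5 F (M 5 (V [:: B 2; B 5; B 0]) F))) (E 5 6 (V [:: B 1; B 2])
  (M 5 F (M 5 F (M 5 (V [:: B 1; B 2; B 5]) F))))) F))) (E 2 5 (M 2 F (M 2 (E 4 3 (E 4 6 (V [::
  B 1; B 2]) (M 4 F (M 4 (V [:: B 2; B 4; B 0]) F))) (E 4 6 (V [:: B 1; B 2]) (M 4 F (M 4 F (M 4
  (V [:: B 1; B 2; B 4]) F))))) F)) (M 2 F (M 2 F (M 2 (E 3 4 (E 3 5 (M 3 (V (block 0 [:: 1; 2;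
  3])) F) (E 3 6 (M 3 (V (block 0 [:: 1; 2; 3])) F) (E 3 7 (M 3 (V (block 0 [:: 1; 2; 3])) F) (M
  3 F (M 3 (V (block 0 [:: 1; 2; 3])) F))))) (E 3 5 (E 3 6 (M 3 (V (block 0 [:: 1; 2; 3])) F) (E
  3 7 (M 3 (V (block 0 [:: 1; 2; 3])) F) (M 3 F (M 3 (V (block 0 [:: 1; 2; 3])) F)))) (E 3 6 (E
  3 7 (M 3 (V (block 0 [:: 1; 2; 3])) F) (M 3 F (M 3 (V (block 0 [:: 1; 2; 3])) F))) (E 3 7 (M 3
  F (M 3 (V (block 0 [:: 1; 2; 3])) F)) (M 3 F (M 3 F (M 3 (V (block 0 [:: 1; 2; 3])) F)))))))
  F))))) F)).

Definition cert_1_4 := M 1 F (M 1 F (M 1 (V [:: B 0; B 1]) (M 1 (V [:: B 0; B 1]) F))).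

Definition cert_2_1 := M 1 (V [:: B 0; B 1]) (M 1 (M 2 (V (block 1 [:: 0; 2])) (V [:: B 0; B
  1])) (M 1 (M 2 (V (block 1 [:: 0; 2])) (M 2 (E 3 4 (V (block 1 [:: 0; 2])) (M 3 (V (block 1
  [:: 0; 2; 3])) (V [:: B 0; B 1]))) (V [:: B 0; B 1]))) (M 1 (M 2 (V (block 1 [:: 0; 2])) (M 2
  (E 3 5 (V (block 1 [:: 0; 2])) (M 3 (V (block 1 [:: 0; 2; 3])) (V [:: B 0; B 1]))) (V [:: B 0;
  B 1]))) (M 1 (M 2 (V (block 1 [:: 0; 2])) (V [:: B 0; B 1])) (M 1 (V [:: B 0; B 1]) (M 1 (V
  [:: B 1]) F)))))).

Definition cert_2_2 := M 1 F (M 1 (E 2 3 (M 2 (M 3 (K [:: 0; 1; 3; 2]) (M 3 (V [:: B 1; B 2; B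
  0; B 3]) (V [:: B 0; B 1; B 2]))) (M 2 (M 3 (V [:: B 0; B 3; B 1; B 2]) (V [:: B 0; B 1; B
  2])) (M 2 (V [:: B 0; B 1; B 2]) (M 2 (V [:: B 2; B 1]) (M 2 (V [:: B 2]) (M 2 (V [:: B 2])
  F)))))) (M 2 F (M 2 (E 3 4 (V [:: B 0; B 1; B 2]) (M 3 F (M 3 (E 4 5 (V [:: B 0; B 3; B 1; B
  2]) (V [:: B 0; B 3; B 1; B 2])) (M 3 (V [:: B 0; B 3; B 1; B 2]) (V [:: B 0; B 2; B 1])))))
  (M 2 (E 3 4 (E 3 5 (V [:: B 0; B 2; B 1]) (M 3 (V [:: B 1; B 2; B 0]) (M 3 (V [:: B 0; B 3; B
  1; B 2]) (V [:: B 2; B 0; B 1])))) (E 3 5 (M 3 (V [:: B 1; B 2; B 0]) (M 3 (V [:: B 0; B 3; B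
  1; B 2]) (V [:: B 2; B 0; B 1]))) (M 3 F (M 3 (V [:: B 0; B 3; B 1; B 2]) (M 3 (V [:: B 0; B
  3; B 1; B 2]) (V [:: B 2; B 0; B 1])))))) (M 2 (E 3 4 (V [:: B 0; B 1; B 2]) (V [:: B 0; B 1;
  B 2])) (M 2 (V [:: B 0; B 2; B 1]) (M 2 (V [:: B 2]) (M 2 (V [:: B 2]) F)))))))) (M 1 (E 2 3
  (E 2 4 (M 2 (M 3 (M 4 (V [:: B 0; B 3; B 4; B 1; B 2]) (V [:: B 1; B 0; B 2; B 3])) (M 3 (E 4
  5 (M 4 (M 5 (V [:: B 1; B 2; B 0; B 5]) (V [:: B 3; B 0; B 4; B 1])) (V [:: B 1; B 0; B 2]))
  (M 4 (V [:: B 1; B 2; B 0; B 4]) (M 4 (E 5 6 (V [:: B 1; B 2; B 0; B 3; B 4]) (M 5 F (M 5 (V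
  [:: B 1; B 0; B 2; B 3; B 5]) (M 5 (V [:: B 1; B 2; B 0; B 5]) (M 5 (V [:: B 3; B 0; B 1; B 2;
  B 5]) (M 5 (V [:: B 5; B 4]) (M 5 (V [:: B 5]) (V [:: B 3; B 0; B 1; B 2; B 4])))))))) (V [::
  B 1; B 0; B 2])))) (V [:: B 0; B 1; B 2]))) (M 2 (M 3 (V [:: B 0; B 1; B 2; B 3]) (V [:: B 0;
  B 1; B 2])) (M 2 (V [:: B 2; B 1]) (M 2 (V [:: B 2]) (M 2 (V [:: B 2]) F))))) (M 2 (M 3 (V [::
  B 0; B 3; B 2; B 1]) (V [:: B 0; B 1; B 2])) (M 2 (M 3 (E 4 5 (V [:: B 0; B 1; B 2; B 3]) (M 4
  F (M 4 (V [:: B 0; B 1; B 2; B 3; B 4]) (V [:: B 2; B 1; B 0; B 3])))) (M 3 (E 4 5 (V [:: B 1;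
  B 2; B 0]) (E 4 6 (M 4 (V [:: B 1; B 2; B 0; B 4]) (V [:: B 2; B 1; B 0])) (M 4 F (M 4 (E 5 6
  (V [:: B 1; B 2; B 0; B 4]) (E 5 7 (V [:: B 1; B 2; B 0; B 4]) (V [:: B 1; B 2; B 0; B 4])))
  (V [:: B 2; B 1; B 0]))))) (V [:: B 0; B 1; B 2]))) (M 2 (M 3 (V [:: B 0; B 1; B 2; B 3]) (V
  [:: B 0; B 1; B 2])) (M 2 (V [:: B 0; B 2; B 1]) (M 2 (V [:: B 2]) (M 2 (V [:: B 2]) F)))))))
  (E 2 4 (M 2 (M 4 (V [:: B 0; B 4; B 2; B 1]) (V [:: B 0; B 1; B 2])) (M 2 (M 4 (E 3 5 (V [:: B
  0; B 1; B 2; B 4]) (M 3 F (M 3 (V [:: B 0; B 1; B 2; B 4; B 3]) (V [:: B 2; B 1; B 0; B 4]))))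
  (M 4 (E 3 5 (V [:: B 1; B 2; B 0]) (E 3 6 (M 3 (V [:: B 1; B 2; B 0; B 3]) (V [:: B 2; B 1; B
  0])) (M 3 F (M 3 (E 5 6 (V [:: B 1; B 2; B 0; B 3]) (E 5 7 (V [:: B 1; B 2; B 0; B 3]) (V [::
  B 1; B 2; B 0; B 3]))) (V [:: B 2; B 1; B 0]))))) (V [:: B 0; B 1; B 2]))) (M 2 (M 4 (V [:: B
  0; B 1; B 2; B 4]) (V [:: B 0; B 1; B 2])) (M 2 (V [:: B 0; B 2; B 1]) (M 2 (V [:: B 2]) (M 2
  (V [:: B 2]) F)))))) (M 2 F (M 2 (E 5 3 (E 5 4 (V [:: B 0; B 1; B 2]) (M 5 (V [:: B 2; B 1; B
  0]) (M 5 (V [:: B 0; B 5; B 2; B 1]) (V [:: B 0; B 1; B 2])))) (E 5 4 (M 5 (V [:: B 2; B 1; B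
  0]) (M 5 (V [:: B 0; B 5; B 2; B 1]) (V [:: B 0; B 1; B 2]))) (M 5 F (M 5 (V [:: B 0; B 5; B
  2; B 1]) (M 5 (V [:: B 0; B 5; B 1; B 2]) (V [:: B 0; B 1; B 2])))))) (M 2 (E 3 5 (E 3 6 (V
  [:: B 0; B 2; B 1]) (M 3 (V [:: B 0; B 1; B 2]) (M 3 (E 5 4 (V [:: B 2; B 1; B 0]) (M 5 (V [::
  B 2; B 1; B 0]) (V [:: B 1; B 2; B 0]))) (V [:: B 0; B 2; B 1])))) (E 3 6 (M 3 (V [:: B 0; B
  1; B 2]) (M 3 (E 4 5 (V [:: B 1; B 0; B 2; B 3]) (E 4 6 (V [:: B 1; B 2; B 0]) (V [:: B 2; B
  1; B 0]))) (V [:: B 0; B 2; B 1]))) (M 3 F (M 3 (E 4 5 (E 4 6 (V [:: B 2; B 1; B 0]) (V [:: B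
  0; B 1; B 2; B 3])) (E 4 6 (V [:: B 0; B 1; B 2; B 3]) (E 4 7 (M 4 (E 7 5 (V [:: B 1; B 2; B
  0; B 3]) (E 7 6 (V [:: B 1; B 2; B 0; B 3]) (V [:: B 1; B 2; B 0; B 3; B 4]))) (V [:: B 2; B
  1; B 0])) (M 4 F (M 4 (E 7 5 (V [:: B 0; B 1; B 2; B 3]) (E 7 6 (V [:: B 0; B 1; B 2; B 3]) (E
  7 8 (V [:: B 0; B 1; B 2; B 3; B 4]) (M 7 F (M 7 (V [:: B 1; B 7; B 3; B 2; B 0]) (M 7 (V [::
  B 1; B 2; B 0; B 3; B 7]) (M 7 (V [:: B 1; B 7; B 3]) (V [:: B 1; B 2; B 0; B 3; B 4]))))))))
  (V [:: B 2; B 1; B 0])))))) (M 3 (E 4 5 (V [:: B 2; B 1; B 0; B 3]) (E 4 6 (V [:: B 1; B 0; B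
  2; B 3]) (V [:: B 2; B 1; B 0]))) (V [:: B 0; B 2; B 1])))))) (M 2 (V [:: B 0; B 1; B 2]) (M 2
  (V [:: B 0; B 2; B 1]) (M 2 (V [:: B 2]) (M 2 (V [:: B 2]) F))))))))) (M 1 (E 2 3 (E 2 4 (E 2
  5 (M 2 (M 3 (V [:: B 0; B 1; B 3; B 2]) (M 3 (E 4 6 (V [:: B 1; B 2; B 0]) (M 4 (V [:: B 0; B
  4; B 3]) (V [:: B 1; B 2; B 0]))) (V [:: B 0; B 1; B 2]))) (M 2 (V [:: B 2; B 1]) (M 2 (V [::
  B 2]) (M 2 (V [:: B 2]) F)))) (M 2 (M 3 (V [:: B 0; B 1; B 2; B 3]) (V [:: B 0; B 1; B 2])) (M
  2 (M 3 (V [:: B 0; B 1; B 2; B 3]) (V [:: B 0; B 1; B 2])) (M 2 (V [:: B 0; B 2; B 1]) (M 2 (V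
  [:: B 2]) (M 2 (V [:: B 2]) F)))))) (E 2 5 (M 2 (M 3 (V [:: B 0; B 1; B 2; B 3]) (V [:: B 0; B
  1; B 2])) (M 2 (M 3 (V [:: B 0; B 1; B 2; B 3]) (V [:: B 0; B 1; B 2])) (M 2 (V [:: B 0; B 2;
  B 1]) (M 2 (V [:: B 2]) (M 2 (V [:: B 2]) F))))) (M 2 (V [:: B 0; B 1; B 2]) (M 2 (M 3 (V [::
  B 0; B 2; B 1; B 3]) (V [:: B 0; B 2; B 1])) (M 2 (V [:: B 0; B 1; B 2]) (M 2 (V [:: B 0; B 2;
  B 1]) (M 2 (V [:: B 2]) (M 2 (V [:: B 2]) F)))))))) (E 2 4 (E 2 5 (M 2 (M 4 (V [:: B 0; B 1; B
  2; B 4]) (V [:: B 0; B 1; B 2])) (M 2 (M 4 (V [:: B 0; B 1; B 2; B 4]) (V [:: B 0; B 1; B 2]))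
  (M 2 (V [:: B 0; B 2; B 1]) (M 2 (V [:: B 2]) (M 2 (V [:: B 2]) F))))) (M 2 (V [:: B 0; B 1; B
  2]) (M 2 (M 4 (V [:: B 0; B 2; B 1; B 4]) (V [:: B 0; B 2; B 1])) (M 2 (V [:: B 0; B 1; B 2])
  (M 2 (V [:: B 0; B 2; B 1]) (M 2 (V [:: B 2]) (M 2 (V [:: B 2]) F))))))) (E 2 5 (M 2 (V [:: B
  0; B 1; B 2]) (M 2 (M 5 (V [:: B 0; B 2; B 1; B 5]) (V [:: B 0; B 2; B 1])) (M 2 (V [:: B 0; B
  1; B 2]) (M 2 (V [:: B 0; B 2; B 1]) (M 2 (V [:: B 2]) (M 2 (V [:: B 2]) F)))))) (M 2 F (M 2
  (E 3 6 (V [:: B 0; B 1; B 2]) (V [:: B 0; B 2; B 1])) (M 2 (V [:: B 0; B 2; B 1]) (M 2 (V [::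
  B 0; B 1; B 2]) (M 2 (V [:: B 0; B 2; B 1]) (M 2 (V [:: B 2]) (M 2 (V [:: B 2]) F)))))))))) (M
  1 (E 2 3 (E 2 4 (E 2 5 (E 2 6 (M 2 (V [:: B 0; B 1; B 2]) (M 2 (V [:: B 2]) (M 2 (V [:: B 2])
  F))) (M 2 (V [:: B 1; B 2]) (M 2 (V [:: B 0; B 1; B 2]) (M 2 (V [:: B 2]) (M 2 (V [:: B 2])
  F))))) (E 2 6 (M 2 (V [:: B 1; B 2]) (M 2 (V [:: B 0; B 1; B 2]) (M 2 (V [:: B 2]) (M 2 (V [::
  B 2]) F)))) (M 2 (V [:: B 1; B 2]) (M 2 (V [:: B 0; B 1; B 2]) (M 2 (V [:: B 0; B 1; B 2]) (M
  2 (V [:: B 2]) (M 2 (V [:: B 2]) F))))))) (E 2 5 (E 2 6 (M 2 (V [:: B 1; B 2]) (M 2 (V [:: B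
  0; B 1; B 2]) (M 2 (V [:: B 2]) (M 2 (V [:: B 2]) F)))) (M 2 (V [:: B 1; B 2]) (M 2 (V [:: B
  0; B 1; B 2]) (M 2 (V [:: B 0; B 1; B 2]) (M 2 (V [:: B 2]) (M 2 (V [:: B 2]) F)))))) (E 2 6
  (M 2 (V [:: B 1; B 2]) (M 2 (V [:: B 0; B 1; B 2]) (M 2 (V [:: B 0; B 1; B 2]) (M 2 (V [:: B
  2]) (M 2 (V [:: B 2]) F))))) (M 2 (V [:: B 1; B 2]) (M 2 (V [:: B 0; B 1; B 2]) (M 2 (V [:: B
  0; B 1; B 2]) (M 2 (V [:: B 0; B 1; B 2]) (M 2 (V [:: B 2]) (M 2 (V [:: B 2]) F))))))))) (E 2
  4 (E 2 5 (E 2 6 (M 2 (V [:: B 1; B 2]) (M 2 (V [:: B 0; B 1; B 2]) (M 2 (V [:: B 2]) (M 2 (V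
  [:: B 2]) F)))) (M 2 (V [:: B 1; B 2]) (M 2 (V [:: B 0; B 1; B 2]) (M 2 (V [:: B 0; B 1; B 2])
  (M 2 (V [:: B 2]) (M 2 (V [:: B 2]) F)))))) (E 2 6 (M 2 (V [:: B 1; B 2]) (M 2 (V [:: B 0; B
  1; B 2]) (M 2 (V [:: B 0; B 1; B 2]) (M 2 (V [:: B 2]) (M 2 (V [:: B 2]) F))))) (M 2 (V [:: B
  1; B 2]) (M 2 (V [:: B 0; B 1; B 2]) (M 2 (V [:: B 0; B 1; B 2]) (M 2 (V [:: B 0; B 1; B 2])
  (M 2 (V [:: B 2]) (M 2 (V [:: B 2]) F)))))))) (E 2 5 (E 2 6 (M 2 (V [:: B 1; B 2]) (M 2 (V [::
  B 0; B 1; B 2]) (M 2 (V [:: B 0; B 1; B 2]) (M 2 (V [:: B 2]) (M 2 (V [:: B 2]) F))))) (M 2 (V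
  [:: B 1; B 2]) (M 2 (V [:: B 0; B 1; B 2]) (M 2 (V [:: B 0; B 1; B 2]) (M 2 (V [:: B 0; B 1; B
  2]) (M 2 (V [:: B 2]) (M 2 (V [:: B 2]) F))))))) (E 2 6 (M 2 (V [:: B 1; B 2]) (M 2 (V [:: B
  0; B 1; B 2]) (M 2 (V [:: B 0; B 1; B 2]) (M 2 (V [:: B 0; B 1; B 2]) (M 2 (V [:: B 2]) (M 2
  (V [:: B 2]) F)))))) (M 2 F (M 2 (V [:: B 0; B 1; B 2]) (M 2 (V [:: B 0; B 1; B 2]) (M 2 (V
  [:: B 0; B 1; B 2]) (M 2 (V [:: B 1; B 2]) (M 2 (V [:: B 2]) (M 2 (V [:: B 2]) F))))))))))) (M
  1 (V [:: B 1]) (M 1 (V [:: B 1]) F)))))).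

Definition cert_2_3 := M 3 F (M 3 F (M 3 (E 2 4 (E 2 5 (M 2 (E 1 4 (E 1 5 (M 1 (M 4 (M 5 (K [::
  0; 4; 5; 1; 2; 3]) F) F) F) (M 1 F (M 1 (E 6 5 (V (block 0 [:: 1; 2; 3])) (M 6 F (M 6 F (M 6
  (V (block 1 [:: 0; 6] ++ [:: P 2; P 3; B 2; B 3])) F)))) F))) (E 1 5 (M 1 F (M 1 (E 6 4 (V
  (block 0 [:: 1; 2; 3])) (M 6 F (M 6 F (M 6 (V (block 1 [:: 0; 6] ++ [:: P 2; P 3; B 2; B 3]))
  F)))) F)) (M 1 F (M 1 F (M 1 (V [:: B 2; B 3; B 0; B 1]) F))))) F) (M 2 F (M 2 (E 4 1 (M 4 (E
  5 1 (E 5 6 (M 5 (V (block 3 [:: 0; 4; 5])) F) (M 5 F (M 5 (E 6 7 (M 6 F (M 6 (V (block 2 [::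
  0; 4; 6])) F)) (M 6 F (M 6 F (M 6 (V (block 2 [:: 0; 4; 6])) F)))) F))) (E 5 6 (M 5 F (M 5 (V
  (block 3 [:: 0; 4; 5] ++ [:: B 2])) F)) (M 5 F (M 5 F (M 5 (V [:: B 0; B 4; B 3; B 5]) F)))))
  F) (M 4 F (M 4 (E 5 1 (E 5 6 (M 5 (V (block 3 [:: 0; 4; 5])) F) (E 5 7 (M 5 (V (block 3 [:: 0;
  4; 5])) F) (M 5 F (M 5 (E 6 1 (V ([:: B 0] ++ block 3 [:: 4; 5])) (E 6 7 (E 6 8 (V ([:: B 0]
  ++ block 3 [:: 4; 5] ++ [:: B 2])) (V [:: B 0; B 5; B 3; B 4; B 2])) (E 6 8 (V ([:: B 0] ++
  block 3 [:: 4; 5] ++ [:: B 2])) (V [:: B 0; B 5; B 3; B 4; B 2])))) F)))) (E 5 6 (E 5 7 (M 5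
  (V (block 3 [:: 0; 4; 5])) F) (M 5 F (M 5 (V (block 3 [:: 0; 4; 5] ++ [:: B 2])) F))) (E 5 7
  (M 5 F (M 5 (E 6 1 (E 6 7 (V (block 3 [:: 0; 4; 5] ++ [:: B 2])) (E 6 8 (M 6 (V (block 2 [::
  0; 4; 6] ++ [:: B 5])) F) (M 6 F (M 6 (V (block 2 [:: 0; 4; 6] ++ [:: B 3; B 5])) F)))) (E 6 7
  (V (block 3 [:: 0; 4; 5] ++ [:: B 2])) (E 6 8 (M 6 F (M 6 (V (block 2 [:: 0; 4; 6] ++ [:: B 3;
  B 5])) F)) (M 6 F (M 6 F (M 6 (V ([:: B 0] ++ block 2 [:: 4; 6] ++ [:: B 3; B 5])) F)))))) F))
  (M 5 F (M 5 F (M 5 (E 1 6 (E 1 7 (V ([:: B 0] ++ block 3 [:: 4; 5])) (E 1 8 (M 1 (V (block 0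
  [:: 1; 2; 3] ++ [:: P 4; P 5; B 4; B 5])) F) (E 1 9 (M 1 (V (block 0 [:: 1; 2; 3] ++ [:: P 4;
  P 5; B 4; B 5])) F) (M 1 F (M 1 (V (block 3 [:: 0; 4; 5] ++ [:: P 1; P 2; B 1; B 2])) F)))))
  (E 1 7 (V ([:: B 0] ++ block 3 [:: 4; 5])) (E 1 8 (E 1 9 (V ([:: B 0] ++ block 3 [:: 4; 5]))
  (M 1 F (M 1 (V ([:: B 0] ++ block 3 [:: 4; 5] ++ [:: B 1; B 2])) F))) (E 1 9 (M 1 F (M 1 (V
  ([:: B 0] ++ block 3 [:: 4; 5] ++ [:: B 1; B 2])) F)) (M 1 F (M 1 F (M 1 (V ([:: B 2] ++ block
  0 [:: 1; 3] ++ [:: B 5; B 4])) F))))))) F)))))) F))) F))) (E 2 5 (M 2 F (M 2 (E 4 1 (E 4 6 (M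
  4 (E 1 5 (V [:: B 0; B 4; B 2; B 3]) (M 1 F (M 1 (V (block 0 [:: 1; 2; 3])) F))) F) (M 4 F (M
  4 (E 5 1 (M 5 (E 6 7 (M 6 F (M 6 (V (block 2 [:: 0; 5; 6])) F)) (M 6 F (M 6 F (M 6 (V (block 2
  [:: 0; 5; 6])) F)))) F) (E 5 7 (M 5 (V (block 3 [:: 0; 4; 5])) F) (M 5 F (M 5 (E 7 6 (V ([:: B
  0] ++ block 3 [:: 4; 5] ++ [:: B 2])) (E 7 8 (V [:: B 0; B 4; B 3; B 5; B 2]) (V ([:: B 0] ++
  block 3 [:: 4; 5] ++ [:: B 2])))) F)))) F))) (E 4 6 (M 4 F (M 4 (E 5 1 (M 5 (V ([:: B 0] ++
  block 3 [:: 4; 5] ++ [:: B 2])) F) (E 5 7 (M 5 (V (block 3 [:: 0; 4; 5])) F) (M 5 F (M 5 (V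
  (block 3 [:: 0; 4; 5] ++ [:: B 2])) F)))) F)) (M 4 F (M 4 F (M 4 (E 1 5 (E 1 6 (M 1 (V (block
  0 [:: 1; 2; 3] ++ [:: B 4])) F) (E 1 7 (M 1 (V ([:: B 3] ++ block 0 [:: 1; 2] ++ [:: B 4])) F)
  (E 1 8 (M 1 (V ([:: B 3] ++ block 0 [:: 1; 2] ++ [:: B 4])) F) (M 1 F (M 1 (M 5 (V ([:: B 0]
  ++ block 3 [:: 4; 5])) F) F))))) (E 1 6 (E 1 7 (M 1 (V ([:: B 2] ++ block 0 [:: 1; 3] ++ [:: B
  4])) F) (E 1 8 (M 1 (V ([:: B 2] ++ block 0 [:: 1; 3] ++ [:: B 4])) F) (M 1 F (M 1 (E 6 7 (V
  ([:: B 3] ++ block 0 [:: 1; 2] ++ [:: B 4])) (E 6 8 (V ([:: B 3] ++ block 0 [:: 1; 2] ++ [:: B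
  4])) (M 6 F (M 6 (V ([:: B 2] ++ block 0 [:: 1; 3] ++ [:: B 4; B 6])) F)))) F)))) (E 1 7 (E 1
  8 (M 1 (V (block 0 [:: 1; 2; 3])) F) (M 1 F (M 1 (E 6 7 (E 6 8 (V (block 0 [:: 1; 2; 3] ++ [::
  B 4])) (V ([:: B 3] ++ block 0 [:: 1; 2] ++ [:: B 4]))) (E 6 8 (V ([:: B 3] ++ block 0 [:: 1;
  2] ++ [:: B 4])) (V ([:: B 3] ++ block 0 [:: 1; 2] ++ [:: B 4])))) F))) (E 1 8 (M 1 F (M 1 (E
  6 7 (V ([:: B 3] ++ block 0 [:: 1; 2] ++ [:: B 4])) (E 6 8 (V ([:: B 3] ++ block 0 [:: 1; 2]
  ++ [:: B 4])) (V ([:: B 3] ++ block 0 [:: 1; 2] ++ [:: B 4])))) F)) (M 1 F (M 1 F (M 1 (E 6 7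
  (V ([:: B 3] ++ block 0 [:: 1; 2] ++ [:: B 4])) (E 6 8 (V ([:: B 3] ++ block 0 [:: 1; 2] ++
  [:: B 4])) (V ([:: B 3] ++ block 0 [:: 1; 2] ++ [:: B 4])))) F))))))) F))))) F)) (M 2 F (M 2 F
  (M 2 (E 1 4 (E 1 5 (M 1 (V [:: B 1; B 3; B 0; B 2]) F) (E 1 6 (M 1 (E 4 7 (V ([:: B 1] ++
  block 0 [:: 2; 3])) (M 4 F (M 4 (E 7 5 (E 7 8 (V (block 0 [:: 1; 2; 3] ++ [:: B 4])) (M 7 F (M
  7 (V (block 0 [:: 1; 2; 3] ++ [:: B 7])) F))) (E 7 8 (V ([:: B 1] ++ block 0 [:: 2; 3] ++ [::
  B 4])) (V ([:: B 1] ++ block 0 [:: 2; 3] ++ [:: B 4])))) F))) F) (E 1 7 (M 1 (E 4 6 (V ([:: B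
  1] ++ block 0 [:: 2; 3])) (M 4 F (M 4 (E 6 5 (E 6 8 (V (block 0 [:: 1; 2; 3] ++ [:: B 4])) (M
  6 F (M 6 (V (block 0 [:: 1; 2; 3] ++ [:: B 6])) F))) (E 6 8 (V ([:: B 1] ++ block 0 [:: 2; 3]
  ++ [:: B 4])) (V ([:: B 1] ++ block 0 [:: 2; 3] ++ [:: B 4])))) F))) F) (M 1 F (M 1 (E 4 6 (M
  4 (V (block 0 [:: 1; 2; 3] ++ [:: B 4])) F) (E 4 7 (M 4 (V (block 0 [:: 1; 2; 3] ++ [:: B 4]))
  F) (M 4 F (M 4 (E 8 5 (V ([:: B 2] ++ block 0 [:: 1; 3])) (E 8 6 (E 8 7 (V ([:: B 2] ++ block
  0 [:: 1; 3])) (E 8 9 (M 8 (V (block 1 [:: 0; 4; 8] ++ [:: P 2; P 3; B 2; B 3])) F) (M 8 F (M 8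
  (V ([:: B 1] ++ block 0 [:: 2; 3] ++ [:: P 4; P 8; B 4; B 8])) F)))) (E 8 7 (E 8 9 (M 8 (V
  (block 1 [:: 0; 4; 8] ++ [:: P 2; P 3; B 2; B 3])) F) (M 8 F (M 8 (V ([:: B 1] ++ block 0 [::
  2; 3] ++ [:: P 4; P 8; B 4; B 8])) F))) (E 8 9 (M 8 F (M 8 (V (block 1 [:: 0; 4; 8] ++ [:: P
  2; P 3; B 2; B 3])) F)) (M 8 F (M 8 F (M 8 (V ([:: B 1] ++ block 0 [:: 2; 3] ++ [:: P 4; P 8;
  B 4; B 8])) F))))))) F)))) F))))) (E 1 5 (E 1 6 (M 1 (E 5 7 (V ([:: B 1] ++ block 0 [:: 2;
  3])) (M 5 F (M 5 (E 7 4 (E 7 8 (V (block 0 [:: 1; 2; 3] ++ [:: B 5])) (M 7 F (M 7 (V (block 0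
  [:: 1; 2; 3] ++ [:: B 7])) F))) (E 7 8 (V ([:: B 1] ++ block 0 [:: 2; 3] ++ [:: B 5])) (V ([::
  B 1] ++ block 0 [:: 2; 3] ++ [:: B 5])))) F))) F) (E 1 7 (M 1 (E 5 6 (V ([:: B 1] ++ block 0
  [:: 2; 3])) (M 5 F (M 5 (E 6 4 (E 6 8 (V (block 0 [:: 1; 2; 3] ++ [:: B 5])) (M 6 F (M 6 (V
  (block 0 [:: 1; 2; 3] ++ [:: B 6])) F))) (E 6 8 (V ([:: B 1] ++ block 0 [:: 2; 3] ++ [:: B
  5])) (V ([:: B 1] ++ block 0 [:: 2; 3] ++ [:: B 5])))) F))) F) (M 1 F (M 1 (E 5 6 (M 5 (V
  (block 0 [:: 1; 2; 3] ++ [:: B 5])) F) (E 5 7 (M 5 (V (block 0 [:: 1; 2; 3] ++ [:: B 5])) F)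
  (M 5 F (M 5 (E 8 4 (V ([:: B 2] ++ block 0 [:: 1; 3])) (E 8 6 (E 8 7 (V ([:: B 2] ++ block 0
  [:: 1; 3])) (E 8 9 (M 8 (V (block 1 [:: 0; 5; 8] ++ [:: P 2; P 3; B 2; B 3])) F) (M 8 F (M 8
  (V ([:: B 1] ++ block 0 [:: 2; 3] ++ [:: P 5; P 8; B 5; B 8])) F)))) (E 8 7 (E 8 9 (M 8 (V
  (block 1 [:: 0; 5; 8] ++ [:: P 2; P 3; B 2; B 3])) F) (M 8 F (M 8 (V ([:: B 1] ++ block 0 [::
  2; 3] ++ [:: P 5; P 8; B 5; B 8])) F))) (E 8 9 (M 8 F (M 8 (V (block 1 [:: 0; 5; 8] ++ [:: P
  2; P 3; B 2; B 3])) F)) (M 8 F (M 8 F (M 8 (V ([:: B 1] ++ block 0 [:: 2; 3] ++ [:: P 5; P 8;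
  B 5; B 8])) F))))))) F)))) F)))) (E 1 6 (E 1 7 (M 1 (V [:: B 1; B 2; B 0; B 3]) F) (M 1 F (M 1
  (E 6 4 (M 6 (V (block 0 [:: 1; 2; 3] ++ [:: B 6])) F) (E 6 5 (M 6 (V (block 0 [:: 1; 2; 3] ++
  [:: B 6])) F) (M 6 F (M 6 (E 7 4 (E 7 5 (V ([:: B 2] ++ block 0 [:: 1; 3])) (E 7 8 (V ([:: B
  2] ++ block 0 [:: 1; 3])) (E 7 9 (M 7 (V (block 2 [:: 0; 6; 7] ++ [:: P 1; P 3; B 1; B 3])) F)
  (M 7 F (M 7 (V ([:: B 0] ++ block 2 [:: 6; 7] ++ [:: B 3; B 1])) F))))) (E 7 5 (E 7 8 (V ([::
  B 2] ++ block 0 [:: 1; 3])) (E 7 9 (M 7 (V (block 2 [:: 0; 6; 7] ++ [:: P 1; P 3; B 1; B 3]))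
  F) (M 7 F (M 7 (V ([:: B 0] ++ block 2 [:: 6; 7] ++ [:: B 3; B 1])) F)))) (E 7 8 (V ([:: B 1]
  ++ block 0 [:: 2; 3])) (E 7 9 (M 7 F (M 7 (V (block 2 [:: 0; 6; 7] ++ [:: P 1; P 3; B 1; B
  3])) F)) (M 7 F (M 7 F (M 7 (E 4 8 (V ([:: B 0] ++ block 2 [:: 6; 7] ++ [:: P 1; P 3; B 1; B
  3])) (E 4 9 (V ([:: B 1] ++ block 0 [:: 2; 3] ++ [:: P 6; P 7; B 6; B 7])) (E 4 10 (V ([:: B
  0] ++ block 2 [:: 6; 7] ++ [:: B 3; B 1])) (V ([:: B 0] ++ block 2 [:: 6; 7] ++ [:: B 3; B
  1]))))) F))))))) F)))) F))) (E 1 7 (M 1 F (M 1 (E 7 4 (M 7 (V (block 0 [:: 1; 2; 3] ++ [:: B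
  7])) F) (E 7 5 (M 7 (V (block 0 [:: 1; 2; 3] ++ [:: B 7])) F) (M 7 F (M 7 (E 6 4 (E 6 5 (V
  ([:: B 2] ++ block 0 [:: 1; 3])) (E 6 8 (V ([:: B 2] ++ block 0 [:: 1; 3])) (E 6 9 (M 6 (V
  (block 2 [:: 0; 6; 7] ++ [:: P 1; P 3; B 1; B 3])) F) (M 6 F (M 6 (V ([:: B 0] ++ block 2 [::
  6; 7] ++ [:: P 1; P 3; B 1; B 3])) F))))) (E 6 5 (E 6 8 (V ([:: B 2] ++ block 0 [:: 1; 3])) (E
  6 9 (M 6 (V (block 2 [:: 0; 6; 7] ++ [:: P 1; P 3; B 1; B 3])) F) (M 6 F (M 6 (V ([:: B 0] ++
  block 2 [:: 6; 7] ++ [:: P 1; P 3; B 1; B 3])) F)))) (E 6 8 (V ([:: B 1] ++ block 0 [:: 2;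
  3])) (E 6 9 (M 6 F (M 6 (V (block 2 [:: 0; 6; 7] ++ [:: P 1; P 3; B 1; B 3])) F)) (M 6 F (M 6
  F (M 6 (V ([:: B 0] ++ block 2 [:: 6; 7] ++ [:: P 1; P 3; B 1; B 3])) F))))))) F)))) F)) (M 1
  F (M 1 F (M 1 (V ([:: B 1] ++ block 0 [:: 2; 3])) F))))))) F))))) F)).

Definition cert_3_1 := M 1 (V [:: B 0; B 1]) (M 1 (M 2 (K [:: 0; 1; 2]) (V [:: B 0; B 1])) (M 1
  (V [:: B 0; B 1]) (M 1 (V [:: B 0; B 1]) (M 1 (V [:: B 1]) (M 1 (V [:: B 1]) (M 1 (V [:: B 1])
  F)))))).

Definition cert_3_2 := M 1 F (M 1 (E 2 3 (M 2 (M 3 (K [:: 0; 1; 3; 2]) (M 3 (V [:: B 3; B 0]) (V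
  [:: B 0; B 1; B 2]))) (M 2 (V [:: B 2; B 1]) (M 2 (V [:: B 2; B 1]) (M 2 (V [:: B 2]) (M 2 (V
  [:: B 2]) (M 2 (V [:: B 2]) F)))))) (M 2 F (M 2 (E 3 4 (V [:: B 0; B 1; B 2]) (M 3 F (M 3 (V
  [:: B 0; B 3; B 1; B 2]) (M 3 (V [:: B 3; B 0; B 1; B 2]) (M 3 (V [:: B 3; B 0]) (V [:: B 0; B
  2; B 1])))))) (M 2 (E 3 4 (E 3 5 (V [:: B 0; B 1; B 2]) (M 3 (V [:: B 2; B 1]) (V [:: B 0; B
  1; B 2]))) (E 3 5 (M 3 (V [:: B 2; B 1]) (V [:: B 0; B 1; B 2])) (M 3 F (M 3 (V [:: B 2; B 0;
  B 1; B 3]) (V [:: B 0; B 2; B 1]))))) (M 2 (E 3 4 (V [:: B 2; B 1]) (E 3 5 (V [:: B 2; B 1])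
  (E 3 6 (V [:: B 2; B 1]) (V [:: B 2; B 1])))) (M 2 (V [:: B 2]) (M 2 (V [:: B 2]) (M 2 (V [::
  B 2]) F)))))))) (M 1 (E 3 2 (M 3 (E 2 4 (V [:: B 0; B 3]) (M 2 (V [:: B 1; B 2]) (V [:: B 0; B
  3]))) (M 3 (V [:: B 3; B 0]) (M 3 (V [:: B 3]) (M 3 (V [:: B 3]) (V [:: B 1]))))) (M 3 F (M 3
  (E 2 4 (E 2 5 (M 2 (V [:: B 1; B 2]) (M 2 (V [:: B 2; B 1]) (M 2 (V [:: B 2]) (M 2 (V [:: B
  2]) (M 2 (V [:: B 2]) F))))) (M 2 (V [:: B 1; B 2]) (M 2 (E 4 5 (V [:: B 1; B 0; B 2]) (M 4 (V
  [:: B 0; B 4]) (V [:: B 1; B 0; B 2]))) (M 2 (V [:: B 2; B 1]) (M 2 (V [:: B 2]) (M 2 (V [:: B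
  2]) (M 2 (V [:: B 2]) F))))))) (E 2 5 (M 2 (V [:: B 1; B 2]) (M 2 (V [:: B 1; B 2]) (M 2 (V
  [:: B 1; B 2]) (M 2 (V [:: B 2]) (M 2 (V [:: B 2]) (M 2 (V [:: B 2]) F)))))) (M 2 F (M 2 (E 6
  4 (V [:: B 1; B 0; B 2; B 3]) (E 6 5 (V [:: B 1; B 2]) (M 6 F (M 6 (V [:: B 0; B 6; B 2; B 1])
  (V [:: B 1; B 0; B 2]))))) (M 2 (E 5 4 (E 5 6 (V [:: B 1; B 0; B 2; B 3]) (E 5 7 (V [:: B 1; B
  0; B 2; B 3]) (M 5 (V [:: B 1; B 5]) (V [:: B 2; B 1; B 0; B 3])))) (E 5 6 (V [:: B 1; B 0; B
  2; B 3]) (E 5 7 (V [:: B 1; B 0; B 2; B 3]) (M 5 F (M 5 (V [:: B 1; B 2; B 5; B 0]) (M 5 (V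
  [:: B 2; B 1; B 0; B 5]) (V [:: B 3; B 2; B 0]))))))) (M 2 (V [:: B 2; B 1]) (M 2 (V [:: B 2])
  (M 2 (V [:: B 2]) (M 2 (V [:: B 2]) F))))))))) (M 3 (E 2 4 (E 2 5 (E 2 6 (M 2 (V [:: B 2; B
  1]) (M 2 (V [:: B 2]) (M 2 (V [:: B 2]) (M 2 (V [:: B 2]) F)))) (M 2 (V [:: B 1; B 0; B 2]) (M
  2 (V [:: B 2; B 1]) (M 2 (V [:: B 2]) (M 2 (V [:: B 2]) (M 2 (V [:: B 2]) F)))))) (E 2 6 (M 2
  (V [:: B 1; B 0; B 2]) (M 2 (V [:: B 2; B 1]) (M 2 (V [:: B 2]) (M 2 (V [:: B 2]) (M 2 (V [::
  B 2]) F))))) (M 2 (V [:: B 1; B 2]) (M 2 (E 5 4 (V [:: B 1; B 2]) (E 5 7 (V [:: B 1; B 0; B 2;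
  B 3]) (V [:: B 1; B 0; B 2; B 3]))) (M 2 (V [:: B 2; B 1]) (M 2 (V [:: B 2]) (M 2 (V [:: B 2])
  (M 2 (V [:: B 2]) F)))))))) (E 2 5 (E 2 6 (M 2 (V [:: B 1; B 2]) (M 2 (V [:: B 1; B 2]) (M 2
  (V [:: B 2]) (M 2 (V [:: B 2]) (M 2 (V [:: B 2]) F))))) (M 2 (V [:: B 3; B 0; B 2]) (M 2 (E 5
  4 (V [:: B 2; B 1; B 0]) (M 5 (V [:: B 2; B 1]) (V [:: B 1; B 2; B 0]))) (M 2 (V [:: B 2; B
  1]) (M 2 (V [:: B 2]) (M 2 (V [:: B 2]) (M 2 (V [:: B 2]) F))))))) (E 2 6 (M 2 (V [:: B 3; B
  0; B 2]) (M 2 (E 4 5 (V [:: B 2; B 1; B 0]) (E 4 6 (V [:: B 2; B 1; B 0]) (E 4 7 (V [:: B 3; B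
  0; B 2]) (V [:: B 2; B 1; B 0])))) (M 2 (V [:: B 2; B 1]) (M 2 (V [:: B 2]) (M 2 (V [:: B 2])
  (M 2 (V [:: B 2]) F)))))) (M 2 F (M 2 (E 7 4 (V [:: B 1; B 0; B 2; B 3]) (E 7 5 (V [:: B 1; B
  0; B 2; B 3]) (E 7 6 (V [:: B 1; B 0; B 2; B 3]) (M 7 F (M 7 (V [:: B 1; B 0; B 2; B 7]) (V
  [:: B 1; B 2])))))) (M 2 (V [:: B 2; B 1; B 0]) (M 2 (V [:: B 2; B 1]) (M 2 (V [:: B 2]) (M 2
  (V [:: B 2]) (M 2 (V [:: B 2]) F)))))))))) (M 3 (V [:: B 3]) (M 3 (V [:: B 3]) (V [:: B
  1]))))))) (M 1 (E 3 2 (M 3 (E 2 4 (V [:: B 0; B 3]) (E 2 5 (V [:: B 0; B 3]) (M 2 (V [:: B 1;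
  B 2]) (V [:: B 0; B 3])))) (V [:: B 1])) (M 3 F (M 3 (E 2 4 (E 2 5 (E 2 6 (M 2 (V [:: B 1; B
  2]) (M 2 (V [:: B 2]) (M 2 (V [:: B 2]) (M 2 (V [:: B 2]) F)))) (M 2 (V [:: B 1; B 2]) (M 2 (V
  [:: B 1; B 2]) (M 2 (V [:: B 2]) (M 2 (V [:: B 2]) (M 2 (V [:: B 2]) F)))))) (E 2 6 (M 2 (V
  [:: B 1; B 2]) (M 2 (V [:: B 1; B 2]) (M 2 (V [:: B 2]) (M 2 (V [:: B 2]) (M 2 (V [:: B 2])
  F))))) (M 2 (V [:: B 1; B 2]) (M 2 (E 4 6 (V [:: B 1]) (M 4 (V [:: B 0; B 4]) (V [:: B 1])))
  (M 2 (V [:: B 2; B 1]) (M 2 (V [:: B 2]) (M 2 (V [:: B 2]) (M 2 (V [:: B 2]) F)))))))) (E 2 5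
  (E 2 6 (M 2 (V [:: B 1; B 2]) (M 2 (V [:: B 1; B 2]) (M 2 (V [:: B 2]) (M 2 (V [:: B 2]) (M 2
  (V [:: B 2]) F))))) (M 2 (V [:: B 1; B 2]) (M 2 (E 5 6 (V [:: B 1]) (M 5 (V [:: B 0; B 5]) (V
  [:: B 1]))) (M 2 (V [:: B 2; B 1]) (M 2 (V [:: B 2]) (M 2 (V [:: B 2]) (M 2 (V [:: B 2])
  F))))))) (E 2 6 (M 2 (V [:: B 1; B 2]) (M 2 (V [:: B 1; B 2]) (M 2 (V [:: B 1; B 2]) (M 2 (V
  [:: B 2]) (M 2 (V [:: B 2]) (M 2 (V [:: B 2]) F)))))) (M 2 F (M 2 (E 7 4 (V [:: B 1; B 2]) (E
  7 5 (V [:: B 1; B 2]) (V [:: B 1; B 2]))) (M 2 (V [:: B 1; B 2]) (M 2 (V [:: B 2; B 1]) (M 2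
  (V [:: B 2]) (M 2 (V [:: B 2]) (M 2 (V [:: B 2]) F)))))))))) (V [:: B 1])))) (M 1 (V [:: B 1])
  (M 1 (V [:: B 1]) (M 1 (V [:: B 1]) F)))))).

Definition cert_3_3 := M 1 F (M 1 F (M 1 (E 4 2 (E 4 3 (M 4 (V [:: B 0; B 4]) F) (M 4 F (M 4 (E
  6 3 (V [:: B 0; B 4]) (E 6 5 (M 6 F (M 6 (V ([:: B 0] ++ block 4 [:: 1; 6])) F)) (M 6 F (M 6 F
  (M 6 (V ([:: B 0] ++ block 4 [:: 1; 6])) F))))) F))) (E 4 3 (M 4 F (M 4 (E 6 2 (V [:: B 0; B
  4]) (E 6 5 (M 6 F (M 6 (V ([:: B 0] ++ block 4 [:: 1; 6])) F)) (M 6 F (M 6 F (M 6 (V ([:: B 0]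
  ++ block 4 [:: 1; 6])) F))))) F)) (M 4 F (M 4 F (M 4 (E 5 2 (E 5 3 (M 5 (V (block 1 [:: 0; 4;
  5])) F) (E 5 6 (M 5 (V (block 1 [:: 0; 4; 5])) F) (E 5 7 (M 5 (V (block 1 [:: 0; 4; 5])) F) (M
  5 F (M 5 (V (block 1 [:: 0; 4; 5])) F))))) (E 5 3 (E 5 6 (M 5 (V (block 1 [:: 0; 4; 5])) F) (E
  5 7 (M 5 (V (block 1 [:: 0; 4; 5])) F) (M 5 F (M 5 (V (block 1 [:: 0; 4; 5])) F)))) (E 5 6 (E
  5 7 (M 5 (V (block 1 [:: 0; 4; 5])) F) (M 5 F (M 5 (V (block 1 [:: 0; 4; 5])) F))) (E 5 7 (M 5
  F (M 5 (V (block 1 [:: 0; 4; 5])) F)) (M 5 F (M 5 F (M 5 (V (block 1 [:: 0; 4; 5])) F)))))))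
  F))))) F)).

(** For the remaining pairs, a single decision on the first vertex suffices; in particular an
    isolated vertex belongs to every maximal set. *)
Definition certs r d :=
  match r, d with
  | 0, 1 => cert_0_1
  | 0, 2 => cert_0_2
  | 1, 1 => cert_1_1
  | 1, 2 => cert_1_2
  | 1, 3 => cert_1_3
  | 1, 4 => cert_1_4
  | 2, 1 => cert_2_1
  | 2, 2 => cert_2_2
  | 2, 3 => cert_2_3
  | 3, 1 => cert_3_1
  | 3, 2 => cert_3_2
  | 3, 3 => cert_3_3
  | _, _ => V [:: B 0]
  end.


(** For [d < 3] the first vertex has minimum degree, so all degrees lie between [d] and 7. For
    [d >= 3] it has maximum degree and all degrees lie between 3 and [d]. The excluded pair is
    treated in [degree_case4]. *)
Lemma certs_ok r d : r < 4 -> d < 8 -> (r, d) != (2, 4) ->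
  check (minn d 3) (if d < 3 then 7 else d) (weight r) (goal r) (comps r) (star d) (certs r d).
Proof.
have : all (fun r => all (fun d => ((r, d) != (2, 4)) ==>
  check (minn d 3) (if d < 3 then 7 else d) (weight r) (goal r) (comps r) (star d) (certs r d))
  (iota 0 8)) (iota 0 4) by vm_compute.
have iI n k : k < n -> k \in iota 0 n by rewrite mem_iota.
move=> /allP H r4 d8; apply/implyP.
by have /allP/(_ d (iI _ _ d8)) := H r (iI _ _ r4).
Qed.

(** * The bound as a function of the order *)

Lemma f_add4 q n : f (4 * q + n) = 6 ^ q * f n.
Proof. by rewrite /f (mulnC 4) divnMDl // modnMDl expnD mulnA. Qed.

(** Reduces a homogeneous inequality between values of [f] at shifted arguments to the four
    residues, with a common factor [6 ^ q]. *)
Lemma f_small n : exists q b, [/\ n = 4 * q + b, b < 4 & forall c, f (n + c) = 6 ^ q * f (b + c)].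
Proof.
exists (n %/ 4), (n %% 4); split; rewrite ?ltn_pmod //; first by rewrite mulnC -divn_eq.
by move=> c; rewrite {1}(divn_eq n 4) (mulnC _ 4) -addnA f_add4.
Qed.

Definition fE := (erefl : f 0 = 6, erefl : f 1 = 8, erefl : f 2 = 11, erefl : f 3 = 18,
  erefl : f 4 = 36, erefl : f 5 = 48, erefl : f 6 = 66, erefl : f 7 = 108, erefl : f 8 = 216,
  erefl : f 9 = 288, erefl : f 10 = 396, erefl : f 11 = 648, erefl : f 12 = 1296).

(** The ratio 3/4 is attained between residues 0 and 1, where it is 6/8. *)
Lemma f_ltS n : f n < f n.+1 /\ 4 * f n <= 3 * f n.+1.
Proof.
have [q [b [_ b4 fqb]]] := f_small n; move: (fqb 0) (fqb 1); rewrite addn0 addn1 => -> ->.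
have : 0 < 6 ^ q by rewrite expn_gt0.
by move: b b4 {fqb} => [|[|[|[|b]]]] //= _; rewrite ?add0n ?add1n ?addn1 !fE; nia.
Qed.

Lemma f_mono m n : m <= n -> f m <= f n.
Proof.
move/subnKC <-; elim: (n - m) => [|k IH]; first by rewrite addn0.
by apply: leq_trans IH _; rewrite addnS ltnW // (f_ltS _).1.
Qed.

Lemma weight0 i : i < 20 -> N.to_nat (nth 0%num weights i) = f i.
Proof.
move=> i20; apply/eqP.
have : all (fun i => N.to_nat (nth 0%num weights i) == f i) (iota 0 20) by vm_compute.
by move/allP; apply; rewrite mem_iota.
Qed.

(** Both sides are values of [f], by [f_add4]. If [k > 16 + r], truncation replaces the argument by
    0, which only enlarges the right-hand side because [f] is increasing. *)
Lemma weightP q r k : r < 4 -> k <= 4 * q + r ->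
  6 ^ 4 * f (4 * q + r - k) <= 6 ^ q * N.to_nat (weight r k).
Proof.
move=> r4 kn; rewrite /weight weight0; last by lia.
by rewrite -!f_add4 f_mono //; lia.
Qed.

(** The sum is the bound for one decision at a vertex of degree [d]. The threshold 8 is sharp here:
    for d = 7 and n = 9 the sum is 216 + 8 * 8 = 280, above 23/24 * 288 = 276. *)
Lemma f_degree8 n d : 8 <= d -> d < n -> 24 * (f n.-1 + d.+1 * f (n.-1 - d)) < 23 * f n.
Proof.
move=> d8; rewrite -(subnKC d8); elim: (d - 8) => [|k IH] dn.
  (* Case d = 8. The tightest residue is n = 1 mod 4, with 216 + 9 * 6 = 270 against 276. *)
  have [c ->] : exists c, n = c + 9 by exists (n - 9); lia.
  have [q [b [_ b4 fqb]]] := f_small c.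
  rewrite addn0; have -> : (c + 9).-1 = c + 8 by lia.
  have -> : c + 8 - 8 = c + 0 by lia.
  rewrite !fqb; have : 0 < 6 ^ q by rewrite expn_gt0.
  move: (6 ^ q) => p p0; clear fqb.
  by move: b b4 => [|[|[|[|b]]]] //= _; rewrite ?addnE /= !fE; nia.
(* Raising d by one multiplies the number of terms by (d+2)/(d+1) and their value by at most 3/4,
   and 3(d+2) <= 4(d+1). *)
have /IH : 8 + k < n by lia.
apply: leq_ltn_trans; rewrite leq_mul2l /= leq_add2l addnS.
have -> : n.-1 - (8 + k) = (n.-1 - (8 + k).+1).+1 by lia.
have [_ le] := f_ltS (n.-1 - (8 + k).+1).
by nia.
Qed.

(** * Numberings of the extremal graphs *)

(* The graph with component [base_rel m] on 0, ..., m - 1 followed by copies of C4. *)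
Definition glue m : rel nat := fun i j => [&& i < m, j < m & base_rel m i j] || c4s m i j.

Lemma c4s_old m t i j : i < m + 4 * t -> m + 4 * t <= j -> c4s m i j = false.
Proof. by rewrite /c4s => ilt jge; apply/negP => /and4P[? ? /eqP ? _]; lia. Qed.

Lemma c4s_sym m : symmetric (c4s m).
Proof. by move=> i j; rewrite /c4s andbCA (eq_sym (_ %/ _)) (eq_sym (odd _)). Qed.

Lemma glue_new m t i j : i < 4 -> j < 4 ->
  glue m (m + 4 * t + i) (m + 4 * t + j) = base_rel 4 i j.
Proof.
move=> i4 j4; rewrite /glue /c4s /base_rel /=.
have -> : m + 4 * t + i < m = false by lia.
have E k : m + 4 * t + k - m = 4 * t + k by lia.
have oE k : odd (4 * t + k) = odd k by rewrite oddD oddM.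
rewrite /= !E !oE -!addnA !leq_addr /=.
by case: eqP => // ne; case: ne; lia.
Qed.

Lemma glue_old m t i j : i < m + 4 * t -> m + 4 * t <= j -> glue m i j = false.
Proof.
move=> ilt jge; rewrite /glue (c4s_old ilt jge) orbF.
by apply/negP => /and3P[_ jm _]; lia.
Qed.

Lemma glue_old' m t i j : i < m + 4 * t -> m + 4 * t <= j -> glue m j i = false.
Proof.
move=> ilt jge; rewrite /glue c4s_sym (c4s_old ilt jge) orbF.
by apply/negP => /and3P[jm _ _]; lia.
Qed.

Section Ext.
Variables (T : finType) (e : rel T).
Hypothesis (sym : symmetric e).
Implicit Types (S A B X : {set T}).

(** Numberings are functions on [nat] rather than on ordinals, so that they can be concatenated by
    shifting the index. *)
Definition numbered n g S (q : nat -> T) :=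
  [/\ forall i j, i < n -> j < n -> q i = q j -> i = j,
      S = toset q (iota 0 n)
    & forall i j, i < n -> j < n -> e (q i) (q j) = g i j].

Lemma in_toset (q : nat -> T) n y : reflect (exists2 i, i < n & y = q i) (y \in toset q (iota 0 n)).
Proof.
by rewrite inE; apply: (iffP mapP) => -[i]; rewrite ?mem_iota => ?; exists i; rewrite ?mem_iota.
Qed.

Lemma card_numbered n g S q : numbered n g S q -> #|S| = n.
Proof.
move=> [inj -> _]; rewrite cardsE -[RHS](size_iota 0) -(size_map q); apply/card_uniqP.
rewrite map_inj_in_uniq ?iota_uniq // => i j; rewrite !mem_iota; exact: inj.
Qed.

Lemma numbered_eq n g g' S q : (forall i j, i < n -> j < n -> g i j = g' i j) ->
  numbered n g S q -> numbered n g' S q.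
Proof. by move=> gg [inj SE E]; split=> // i j iN jN; rewrite E ?gg. Qed.

Lemma numbered_cat n1 n2 g1 g2 A B q1 q2 :
  numbered n1 g1 A q1 -> numbered n2 g2 B q2 -> [disjoint A & B] ->
  (forall x y, x \in A -> y \in B -> ~~ e x y) ->
  numbered (n1 + n2) (fun i j => if i < n1 then (j < n1) && g1 i j
                                 else (n1 <= j) && g2 (i - n1) (j - n1))
    (A :|: B) (fun i => if i < n1 then q1 i else q2 (i - n1)).
Proof.
move=> [inj1 AE E1] [inj2 BE E2] dAB noe.
have inA i : i < n1 -> q1 i \in A by move=> ?; rewrite AE; apply/in_toset; exists i.
have inB i : i < n2 -> q2 i \in B by move=> ?; rewrite BE; apply/in_toset; exists i.
have neq i j : i < n1 -> j < n2 -> q1 i <> q2 j.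
  by move=> /inA iA /inB jB E; have := disjointFr dAB iA; rewrite E jB.
split.
- move=> i j iN jN; case: ltnP => i1; case: ltnP => j1 E.
  + exact: inj1.
  + by case: (@neq i (j - n1)) => //; lia.
  + by case: (@neq j (i - n1)) => //; lia.
  + by have := inj2 (i - n1) (j - n1); rewrite E => H; have := H _ _ erefl; lia.
- apply/setP => y; rewrite inE; apply/orP/in_toset => [[]|[i iN ->]].
  + rewrite AE => /in_toset[i iN ->]; exists i; [lia|by rewrite iN].
  + rewrite BE => /in_toset[i iN ->]; exists (n1 + i); first lia.
    by rewrite ltnNge leq_addr /= addKn.
  + by case: ltnP => i1; [left; exact: inA|right; apply: inB; lia].
move=> i j iN jN; case: (ltnP i n1) => i1; case: (ltnP j n1) => j1 /=.
- exact: E1.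
- by apply/negbTE/noe; [exact: inA|apply: inB; lia].
- by rewrite sym; apply/negbTE/noe; [exact: inA|apply: inB; lia].
- by apply: E2; lia.
Qed.

Definition cnt m := count (mdsb m) (subs (iota 0 m)).

(** The enumeration gives 1, 3, 6, 8, 11. The value m = 0 stands for an empty base component, as in
    the disjoint union of copies of C4 alone. *)
Lemma cntP m : m \in [:: 0; 3; 4; 5; 6] -> 6 * cnt m = f m.
Proof. by rewrite !inE => /or4P[/eqP->|/eqP->|/eqP->|/orP[]/eqP->]. Qed.

Lemma phis_base m S q : m \in [:: 0; 3; 4; 5; 6] -> numbered m (base_rel m) S q ->
  phis e S = cnt m.
Proof.
move=> mm [inj -> E]; apply: phis_toset => //.
- by move: mm; rewrite !inE => /or4P[/eqP->|/eqP->|/eqP->|/orP[]/eqP->].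
- by move: mm; rewrite !inE => /or4P[/eqP->|/eqP->|/eqP->|/orP[]/eqP->].
- by move: mm; rewrite !inE => /or4P[/eqP->|/eqP->|/eqP->|/orP[]/eqP->].
Qed.

Lemma component_numbered S m q : component e S m q ->
  numbered m (base_rel m) (toset q (iota 0 m)) q.
Proof. by move=> [C1 C2 C3 C4]; split. Qed.

Lemma component_sub S m q : component e S m q -> toset q (iota 0 m) \subset S.
Proof. by move=> [C1 _ _ _]; apply/subsetP => y /in_toset[i im ->]; exact: C1. Qed.

Lemma component_closed_in S m q : component e S m q ->
  forall x y, x \in toset q (iota 0 m) -> y \in S -> e x y -> y \in toset q (iota 0 m).
Proof.
move=> [_ _ _ C4] x y /in_toset[i im ->] yS iy.
by have [j jm ->] := C4 i y im yS iy; apply/in_toset; exists j.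
Qed.

Lemma component_split S m q : m \in [:: 0; 3; 4; 5; 6] -> component e S m q ->
  phis e S = cnt m * phis e (S :\: toset q (iota 0 m)) /\
  #|S| = m + #|S :\: toset q (iota 0 m)|.
Proof.
move=> mm C; have N := component_numbered C; have sub := component_sub C.
rewrite (phis_disjoint sym sub (component_closed_in C)) (phis_base mm N); split=> //.
by rewrite cardsD (setIidPr sub) (card_numbered N) subnKC // -(card_numbered N) subset_leq_card.
Qed.

Definition ext_at m t S := exists q, numbered (m + 4 * t) (glue m) S q.

Lemma ext_card m t S : ext_at m t S -> #|S| = m + 4 * t.
Proof. by move=> [q /card_numbered]. Qed.

(** Induction on [t]: the last four numbers form a C4 component, which contributes the factor 6. *)
Lemma ext_phi m t S : m \in [:: 0; 3; 5; 6] -> ext_at m t S -> 6 * phis e S = f (m + 4 * t).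
Proof.
move=> mm; have mm' : m \in [:: 0; 3; 4; 5; 6] by move: mm; rewrite !inE => /or4P[]->; rewrite ?orbT.
elim: t S => [|t IH] S [q N].
  rewrite muln0 addn0 in N *.
  rewrite (@phis_base m S q mm') ?cntP //; apply: numbered_eq N => i j im jm.
  by rewrite /glue im jm /= /c4s leqNgt im orbF.
have nE : m + 4 * t.+1 = m + 4 * t + 4 by lia.
have [inj SE E] := N; rewrite nE in inj SE E *.
set n := m + 4 * t in inj SE E *.
have C : component e S 4 (fun i => q (n + i)).
  split.
  - by move=> i i4; rewrite SE; apply/in_toset; exists (n + i); rewrite ?ltn_add2l.
  - by move=> i j i4 j4 /inj; rewrite !ltn_add2l => /(_ i4 j4)/addnI.
  - by move=> i j i4 j4; rewrite E ?ltn_add2l // glue_new.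
  move=> i y i4; rewrite SE => /in_toset[j jn ->]; rewrite E ?ltn_add2l //.
  case: (ltnP j n) => jlt; first by rewrite (glue_old' jlt) // leq_addr.
  by exists (j - n); rewrite ?subnKC //; lia.
have four : 4 \in [:: 0; 3; 4; 5; 6] by [].
have [pE cE] := component_split four C.
have E' : ext_at m t (S :\: toset (fun i => q (n + i)) (iota 0 4)).
  exists q; split; [by move=> i j iN jN; apply: inj; lia| |by move=> i j iN jN; apply: E; lia].
  apply/setP => y; rewrite inE; apply/andP/in_toset => [[yZ]|[i iN ->]].
    rewrite SE => /in_toset[i iN yi]; exists i => //.
    rewrite ltnNge; apply: contraNN yZ => ni.
    by apply/in_toset; exists (i - n); rewrite ?subnKC //; lia.
  split; last by rewrite SE; apply/in_toset; exists i => //; lia.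
  by apply/in_toset => -[j j4 /inj]; lia.
rewrite pE mulnA (cntP four) fE addnC (f_add4 1 (m + 4 * t)) -(IH _ E'); lia.
Qed.

Lemma ext_add4 m t S q : component e S 4 q -> ext_at m t (S :\: toset q (iota 0 4)) ->
  ext_at m t.+1 S.
Proof.
move=> C [q' N]; have N4 := component_numbered C.
have := numbered_cat N N4; set Z := toset q _ in N4 N *.
have sub : Z \subset S := component_sub C.
case.
- by rewrite disjoint_sym disjoints_subset; apply/subsetP => y yZ; rewrite in_setC in_setD yZ.
- move=> x y; rewrite in_setD => /andP[xZ xS] yZ; apply: contraNN xZ; rewrite sym.
  exact: (component_closed_in C).
move=> inj SE E; exists (fun i => if i < m + 4 * t then q' i else q (i - (m + 4 * t))).
rewrite (_ : m + 4 * t.+1 = m + 4 * t + 4); last by lia.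
split=> //.
  by rewrite -SE setUC -{1}(setIidPr sub) setID.
move=> i j iN jN; rewrite E //; case: (ltnP i) => il; case: (ltnP j) => jl /=.
- by [].
- by rewrite (glue_old il jl).
- by rewrite (glue_old' jl il).
rewrite -{2}(subnKC il) -{2}(subnKC jl) glue_new //; lia.
Qed.

Lemma ext_base m t S q : component e S m q -> ext_at 0 t (S :\: toset q (iota 0 m)) ->
  ext_at m t S.
Proof.
move=> C [q' N]; have Nm := component_numbered C.
have := numbered_cat Nm N; set Z := toset q _ in Nm N *.
have sub : Z \subset S := component_sub C.
case.
- by rewrite disjoint_sym disjoints_subset; apply/subsetP => y; rewrite in_setC in_setD => /andP[].
- move=> x y xZ; rewrite in_setD => /andP[yZ yS]; apply: contraNN yZ.
  exact: (component_closed_in C).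
move=> inj SE E; exists (fun i => if i < m then q i else q' (i - m)).
split=> //; first by rewrite -SE -{1}(setIidPr sub) setID.
move=> i j iN jN; rewrite E //; rewrite /glue /c4s; case: (ltnP i) => il; case: (ltnP j) => jl /=.
- by rewrite orbF.
- by [].
- by [].
by rewrite !subn0.
Qed.

End Ext.

(** * The induction *)

Section Main.
Variables (T : finType) (e : rel T).
Hypothesis (sym : symmetric e) (irr : irreflexive e) (tri : triangle_free e).
Variable x0 : T.
Implicit Types (S X : {set T}).

Lemma nbh_set0 : nbh e set0 = set0.
Proof.
by apply/setP => y; rewrite !inE; apply/existsP => -[x]; rewrite inE.
Qed.

Lemma nbh_set1 (x y : T) : (y \in nbh e [set x]) = e x y.
Proof.
rewrite inE; apply/existsP/idP => [[z]|xy]; first by rewrite inE => /andP[/eqP->].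
by exists x; rewrite inE eqxx.
Qed.

(* The summands: [v] outside [F], [v] isolated in [F], [v] matched with [u]. *)
Lemma phis_vertex S v k : v \in S ->
  (forall X, #|X| < #|S| -> 6 * phis e X <= f #|X|) ->
  (forall u, u \in nbs e S v -> k <= #|nbs e S u|) ->
  6 * phis e S <= 6 * phis e (S :\ v) + f (#|S|.-1 - #|nbs e S v|)
                  + #|nbs e S v| * f (#|S| - (#|nbs e S v| + k)).
Proof.
move=> vS IH deg; set N := nbs e S v.
have rest X c : 0 < c -> c <= #|S :&: X| -> 6 * phis e (S :\: X) <= f (#|S| - c).
  move=> c0 cX; have cS : #|S :&: X| <= #|S| by rewrite subset_leq_card ?subsetIl.
  have cD : #|S :\: X| = #|S| - #|S :&: X| by rewrite cardsD.
  apply: leq_trans (IH _ _) _; first by lia.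
  by apply: f_mono; rewrite cD; lia.
pose C0 := [set F | mds e S F & v \notin F].
pose C1 := [set F | mds e S F & (v \in F) && [forall y in F, ~~ e v y]].
pose C2 u := [set F | mds e S F & (v \in F) && (u \in F)].
have cover : [set F | mds e S F] \subset C0 :|: (C1 :|: \bigcup_(u in N) C2 u).
  apply/subsetP => F; rewrite !inE => mF; rewrite mF /=.
  case vF: (v \in F) => //=; case: (boolP [forall y in F, _]) => //=.
  rewrite negb_forall_in => /exists_inP[y yF]; rewrite negbK => vy.
  have /mdsP[FS _ _] := mF.
  by apply/bigcupP; exists y; rewrite !inE ?vy ?(subsetP FS) // mF vF.
have c0 : #|C0| <= phis e (S :\ v).
  have := class_bound sym (S := S) (I := set0) (D := [set v]) (C := C0).
  rewrite nbh_set0 setU0; apply; first exact: sub0set.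
  move=> F; rewrite inE => /andP[mF vF]; split=> //; first exact: sub0set.
    by rewrite setD0 disjoint_sym disjoints1.
  by move=> x y; rewrite inE.
have c1 : 6 * #|C1| <= f (#|S|.-1 - #|N|).
  have := class_bound sym (S := S) (I := [set v]) (D := [set v]) (C := C1).
  set R := S :\: _ => H; have {}H : #|C1| <= phis e R.
    apply: H => // F; rewrite inE => /and3P[mF vF /forall_inP al]; split=> //.
    - by rewrite sub1set.
    - by rewrite setDv disjoint_sym disjoints_subset sub0set.
    - by move=> x y; rewrite inE => /eqP-> /al/negP.
  apply: leq_trans (leq_mul (leqnn 6) H) _; rewrite (_ : _ - _ = #|S| - #|N|.+1); last by lia.
  apply: rest => //; rewrite (_ : _ :&: _ = v |: N); first by rewrite cardsU1 inE irr andbF.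
  apply/setP => y; rewrite in_setI in_setU in_set1 nbh_set1 in_setU1 inE.
  by case: (eqVneq y v) => [->|]; rewrite ?vS.
have c2 u : u \in N -> 6 * #|C2 u| <= f (#|S| - (#|N| + k)).
  move=> uN; have := deg u uN; move: (uN); rewrite inE => /andP[uS vu] ku.
  have uv : e u v by rewrite sym.
  have := class_bound sym (S := S) (I := [set v; u]) (D := [set v; u]) (C := C2 u).
  set R := S :\: _ => H; have {}H : #|C2 u| <= phis e R.
    apply: H => // F; rewrite inE => /and3P[mF vF uF]; have /mdsP[_ /dissP dF _] := mF; split=> //.
    - by apply/subsetP => y; rewrite !inE => /orP[]/eqP->.
    - by rewrite setDv disjoint_sym disjoints_subset sub0set.
    - move=> x y; rewrite !inE => /orP[]/eqP-> yF xy.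
        by rewrite (dF _ _ _ vF yF uF xy vu) eqxx orbT.
      by rewrite (dF _ _ _ uF yF vF xy uv) eqxx.
  apply: leq_trans (leq_mul (leqnn 6) H) _.
  have N0 : 0 < #|N| by apply/card_gt0P; exists u.
  apply: rest; first by lia.
  (* Triangle-freeness makes the neighbourhoods of the adjacent vertices [v] and [u] disjoint. Their
     union contains [v] and [u] and is entirely deleted, hence the count [#|N| + k]. *)
  have dNN : N :&: nbs e S u = set0.
    apply/setP => y; rewrite !inE; apply/negP => /andP[/andP[_ vy] /andP[_ uy]].
    by apply: (tri vu uy); rewrite sym.
  apply: (@leq_trans #|N :|: nbs e S u|).
    by rewrite cardsU dNN cards0 subn0 leq_add2l.
  apply: subset_leq_card; apply/subsetP => y; rewrite in_setU in_setI in_setU => yNN.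
  have yS : y \in S by case/orP: yNN; rewrite inE => /andP[].
  rewrite yS; apply/orP; right; rewrite inE; apply/existsP.
  by case/orP: yNN; rewrite inE => /andP[_ ?]; [exists v|exists u]; rewrite !inE eqxx ?orbT.
have cU : #|[set F | mds e S F]| <= #|C0| + (#|C1| + \sum_(u in N) #|C2 u|).
  apply: leq_trans (subset_leq_card cover) _.
  apply: leq_trans (leq_card_setU _ _) _; rewrite leq_add2l.
  apply: leq_trans (leq_card_setU _ _) _; rewrite leq_add2l.
  elim/big_rec2: _ => [|u m B _ IHB]; first by rewrite cards0.
  by apply: leq_trans (leq_card_setU _ _) _; rewrite leq_add2l.
have cS : 6 * \sum_(u in N) #|C2 u| <= #|N| * f (#|S| - (#|N| + k)).
  by rewrite big_distrr /= -sum_nat_const; apply: leq_sum.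
rewrite [phis e S]/phis; move: c0 c1 cU cS; lia.
Qed.

Lemma real_star S v : v \in S ->
  real e S (star #|nbs e S v|) (fun i => if i is j.+1 then nth x0 (enum (nbs e S v)) j else v).
Proof.
move=> vS; set N := nbs e S v; set s := enum N.
have ss : size s = #|N| by rewrite cardE.
have sN j : j < #|N| -> nth x0 s j \in N by move=> jN; rewrite -mem_enum mem_nth ?ss.
have vN : v \notin N by rewrite inE irr andbF.
have nbrE i : nbr (star #|N|) i = if i is j.+1 then (if j < #|N| then [:: 0] else [::]) else iota 1 #|N|.
  by case: i => // j; rewrite /nbr /= nth_nseq.
split.
- by case=> [|j] //= jN; have := sN j jN; rewrite inE => /andP[].
- case=> [|i] [|j] //=; rewrite ?ltnS => iN jN E.
  + by have := sN j jN; rewrite -E (negPf vN).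
  + by have := sN i iN; rewrite E (negPf vN).
  + by congr _.+1; apply/eqP; rewrite -(nth_uniq x0 _ _ (enum_uniq (mem N))) ?ss // E.
- move=> [|i] j; rewrite nbrE.
    rewrite mem_iota /=; case: j => [|j] //=; rewrite add1n ltnS => jN; split=> //.
    by have := sN j jN; rewrite inE => /andP[].
  case: ifP => // iN; rewrite inE => /eqP->; split=> //=.
  by have := sN i iN; rewrite inE sym => /andP[].
- by case=> [|i]; rewrite nbrE ?iota_uniq //; case: ifP.
- by [].
- by move=> i; rewrite inE => /eqP->.
move=> i y; rewrite inE => /eqP-> yS vy.
have yN : y \in N by rewrite inE yS.
exists (index y s).+1; last by rewrite nth_index // mem_enum.
by rewrite nbrE mem_iota /= add1n ltnS -ss index_mem mem_enum.
Qed.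

Definition rbase r := nth 0 [:: 0; 5; 6; 3] r.
Definition ext S := exists t, ext_at e (rbase (#|S| %% 4)) t S.
(** The margin has to survive the restoring of components: C4 keeps the residue, and each other
    component is added to a rest of residue 0. *)
Definition gap S :=
  if #|S| %% 4 < 2 then 24 * (6 * phis e S) < 23 * f #|S| else 6 * phis e S < f #|S|.

Lemma gap_lt S : gap S -> 6 * phis e S < f #|S|.
Proof. by rewrite /gap; case: ifP => // _; lia. Qed.

Lemma gap24 S : 24 * (6 * phis e S) < 23 * f #|S| -> gap S.
Proof. by rewrite /gap; case: ifP => // _; lia. Qed.

Lemma ext_eq S : ext S -> 6 * phis e S = f #|S|.
Proof.
move=> [t E]; rewrite (ext_card E); apply: (ext_phi sym) E.
by rewrite /rbase; have := ltn_pmod #|S| (isT : 0 < 4); case: (_ %% 4) => [|[|[|[|]]]].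
Qed.

Lemma compsP r m : r < 4 -> m \in comps r ->
  m = 4 \/ [/\ m \in [:: 3; 5; 6], m = rbase r & m %% 4 = r].
Proof.
case: r => [|[|[|[|]]]] //= _; rewrite /comps /= !inE;
  by [move/eqP; left | case/orP => /eqP->; [left|right]].
Qed.

(** Multiplicativity carries the margin of the rest over to [S], because f(m + k) = cnt(m) f(k) when
    m = 4 or 4 divides k. If the rest is extremal, its numbering is extended by the component. *)
Lemma component_case S m q : component e S m q -> m \in comps (#|S| %% 4) ->
  (forall X, #|X| < #|S| -> ext X \/ gap X) -> ext S \/ gap S.
Proof.
move=> C mr IH; set Z := toset q (iota 0 m).
have r4 := ltn_pmod #|S| (isT : 0 < 4).
have mP := compsP r4 mr.
have mm : m \in [:: 0; 3; 4; 5; 6].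
  by case: mP => [->|[m3 _ _]] //; move: m3; rewrite !inE => /or3P[]->; rewrite ?orbT.
have [pE cE] := component_split sym mm C; rewrite -/Z in pE cE.
have m0 : 0 < m.
  by case: mP => [->|[m3 _ _]] //; move: m3; rewrite !inE => /or3P[]/eqP->.
have [E|G] := IH (S :\: Z) ltac:(lia).
  left; case: E => t E; case: mP => [m4|[_ mE mr4]].
    subst m; exists t.+1; rewrite cE modnDl in E *.
    exact: (ext_add4 sym C E).
  have r0 : #|S :\: Z| %% 4 = 0 by lia.
  by exists t; rewrite -mE; rewrite r0 in E; exact: (ext_base sym C E).
right; have c6 := cntP mm; move: G; rewrite /gap pE cE.
case: mP => [->|[m3 _ mr4]].
  by rewrite modnDl (f_add4 1) (_ : cnt 4 = 6) //; case: ifP => _; lia.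
have r0 : #|S :\: Z| %% 4 = 0 by lia.
have [z zE] : exists z, #|S :\: Z| = 4 * z by exists (#|S :\: Z| %/ 4); lia.
have -> : f (m + #|S :\: Z|) = 6 ^ z * f m by rewrite zE addnC f_add4.
have -> : f #|S :\: Z| = 6 ^ z * 6 by rewrite zE -[4 * z]addn0 f_add4 fE.
rewrite r0 /=; have : 0 < 6 ^ z by rewrite expn_gt0.
move: (6 ^ z) (phis e _) c6 => P ph c6 P0.
rewrite !inE in m3; case/or3P: m3 => /eqP mE; rewrite mE fE in c6 *;
  by move: c6; move: (cnt _) => k; case: ifP => _; nia.
Qed.

Lemma card_res n : exists q r, n = 4 * q + r /\ r < 4.
Proof. by exists (n %/ 4), (n %% 4); split; lia. Qed.

Lemma goalP r : r < 4 ->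
  if r < 2 then 24 * N.to_nat (goal r) = 23 * f (4 * 4 + r) else N.to_nat (goal r) = f (4 * 4 + r).
Proof.
move=> r4; have : all (fun r => if r < 2 then 24 * N.to_nat (goal r) == 23 * f (4 * 4 + r)
  else N.to_nat (goal r) == f (4 * 4 + r)) (iota 0 4) by vm_compute.
by move/allP/(_ r); rewrite mem_iota => /(_ r4); case: ifP => _ /eqP.
Qed.

Lemma machine_case S dmin cap d ct p :
  (forall x, x \in S -> dmin <= #|nbs e S x|) ->
  (forall x, x \in S -> #|nbs e S x| <= cap) ->
  real e S (star d) p ->
  check dmin cap (weight (#|S| %% 4)) (goal (#|S| %% 4)) (comps (#|S| %% 4)) (star d) ct ->
  (forall X, #|X| < #|S| -> ext X \/ gap X) -> ext S \/ gap S.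
Proof.
move=> dmn dmx re ch IH.
have [q [r [nE r4]]] := card_res #|S|.
have rE : #|S| %% 4 = r by lia.
rewrite rE in ch.
have IHle X : #|X| < #|S| -> 6 * phis e X <= f #|X|.
  by move=> /IH[/ext_eq->//|/gap_lt/ltnW].
have wP X k : 0 < k -> k <= #|S :&: X| ->
    (6 ^ 4 * 6) * phis e (S :\: X) <= 6 ^ q * N.to_nat (weight r k).
  move=> k0 kX; have cS : #|S :&: X| <= #|S| by rewrite subset_leq_card ?subsetIl.
  have cD : #|S :\: X| = #|S| - #|S :&: X| by rewrite cardsD.
  apply: leq_trans (weightP r4 _); last by rewrite -nE; lia.
  rewrite -mulnA leq_mul2l; apply/orP; right; apply: leq_trans (IHle _ _) _; first by lia.
  by apply: f_mono; rewrite cD -nE; lia.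
have q0 : 0 < 6 ^ q by rewrite expn_gt0.
have [[v vle vlt]|[m [q' [mk C]]]] := check_sound sym irr tri dmn dmx wP re ch; last first.
  by apply: component_case C _ IH; rewrite rE.
right; rewrite /gap rE nE f_add4.
have {}vlt : N.to_nat v < N.to_nat (goal r).
  by move/N.ltb_lt: vlt => vlt; lia.
have := goalP r4; rewrite f_add4.
move: (phis e S) (6 ^ q) q0 vle vlt => ph P P0 vle vlt.
by case: ifP => _; move: (N.to_nat v) (N.to_nat _) (f r) vle vlt => v' g fr; nia.
Qed.

Lemma degree_case8 S v : v \in S -> 8 <= #|nbs e S v| ->
  (forall X, #|X| < #|S| -> ext X \/ gap X) -> gap S.
Proof.
move=> vS d8 IH; apply: gap24.
have IHle X : #|X| < #|S| -> 6 * phis e X <= f #|X|.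
  by move=> /IH[/ext_eq->//|/gap_lt/ltnW].
have deg1 u : u \in nbs e S v -> 1 <= #|nbs e S u|.
  by rewrite inE => /andP[uS vu]; apply/card_gt0P; exists v; rewrite inE vS sym.
have := phis_vertex vS IHle deg1; set d := #|_| in d8 *.
have dn : d < #|S|.
  rewrite [X in _ < X](cardsD1 v) vS add1n ltnS; apply: subset_leq_card.
  by apply/subsetP => y; rewrite !inE => /andP[-> vy]; rewrite andbT; apply: contraTneq vy => ->; rewrite irr.
have := f_degree8 d8 dn.
have cv : #|S :\ v| = #|S|.-1 by rewrite (cardsD1 v S) vS.
have := IHle (S :\ v); rewrite cv => /(_ ltac:(lia)).
have -> : #|S| - (d + 1) = #|S|.-1 - d by lia.
by rewrite mulSn; lia.
Qed.

(* [S :\ v] is not extremal: its vertices of degree 2 would all be adjacent to [v],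
   which creates a triangle or leaves [v] with only three neighbours. *)
Lemma degree_case4 S v : v \in S -> #|nbs e S v| = 4 -> #|S| %% 4 = 2 ->
  (forall x, x \in S -> 3 <= #|nbs e S x|) ->
  (forall X, #|X| < #|S| -> ext X \/ gap X) -> gap S.
Proof.
move=> vS d4 r2 deg IH.
have IHle X : #|X| < #|S| -> 6 * phis e X <= f #|X|.
  by move=> /IH[/ext_eq->//|/gap_lt/ltnW].
have cv : #|S| = #|S :\ v|.+1 by rewrite (cardsD1 v S) vS.
have deg3 u : u \in nbs e S v -> 3 <= #|nbs e S u| by rewrite inE => /andP[/deg].
have := phis_vertex vS IHle deg3; rewrite d4.
have [E|G] := IH (S :\ v) ltac:(lia); last first.
  (* The disjoint neighbourhoods of [v] and of one of its neighbours have at least 4 + 3 vertices;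
     with residue 2 this gives n >= 10, so that [c] below exists. *)
  have n7 : 7 <= #|S|.
    have /card_gt0P[u uN] : 0 < #|nbs e S v| by rewrite d4.
    move: (uN); rewrite inE => /andP[uS vu].
    have : nbs e S v :|: nbs e S u \subset S by apply/subsetP => y; rewrite !inE => /orP[]/andP[].
    move/subset_leq_card; rewrite cardsU (_ : _ :&: _ = set0) ?cards0; first by have := deg u uS; lia.
    apply/setP => y; rewrite !inE; apply/negP => /andP[/andP[_ vy] /andP[_ uy]].
    by apply: (tri vu uy); rewrite sym.
  have [c nE] : exists c, #|S| = 4 * c + 10 by exists ((#|S| - 10) %/ 4); lia.
  move: G; rewrite /gap r2 (_ : #|S :\ v| %% 4 = 1); last by lia.
  rewrite (_ : #|S :\ v| = 4 * c + 9); last by lia.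
  rewrite nE (_ : _.-1 - 4 = 4 * c + 5); last by lia.
  rewrite (_ : _ - _ = 4 * c + 3); last by lia.
  (* In units of [6 ^ c] the sum is less than 276 + 48 + 72 = 396, the strictness coming from the
     gap of [S :\ v]. *)
  rewrite !f_add4 !fE /=; lia.
case: E => t; rewrite (_ : #|S :\ v| %% 4 = 1); last by lia.
rewrite /rbase /= => -[q [inj SE E]] _; exfalso.
have inS i : i < 5 + 4 * t -> q i \in S /\ q i != v.
  move=> iN; have : q i \in S :\ v by rewrite SE; apply/in_toset; exists i.
  by rewrite !inE => /andP[].
(* A vertex with at most two neighbours in [S :\ v] must be adjacent to [v], since its degree in [S]
   is at least 3. *)
have adj i a b : i < 5 + 4 * t -> (forall j, j < 5 + 4 * t -> glue 5 i j -> (j == a) || (j == b)) -> e v (q i).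
  move=> iN H; apply: contraT => nvi; have [qS _] := inS i iN.
  have sub : nbs e S (q i) \subset [set q a; q b].
    apply/subsetP => y; rewrite inE => /andP[yS iy].
    have : y \in S :\ v.
      by rewrite !inE yS andbT; apply: contraNneq nvi => <-; rewrite sym.
    rewrite SE => /in_toset[j jN yE]; rewrite yE E // in iy *.
    by rewrite !inE; case/orP: (H j jN iy) => /eqP->; rewrite eqxx ?orbT.
  have := leq_trans (deg _ qS) (subset_leq_card sub); rewrite cards2.
  by case: (_ != _).
have adj2 : e v (q 2).
  by apply: (@adj 2 0 1) => // j _; rewrite /glue /base_rel /c4s /=; lia.
have t0 : t = 0.
  (* In a C4 component two consecutive vertices, here 5 and 6, would both be adjacent to [v]. *)
  case: t {SE} inj E inS adj adj2 => // t inj E inS adj adj2; exfalso.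
  have v5 : e v (q 5) by apply: (@adj 5 6 8) => [|j _]; rewrite /glue /base_rel /c4s /=; lia.
  have v6 : e v (q 6) by apply: (@adj 6 5 7) => [|j _]; rewrite /glue /base_rel /c4s /=; lia.
  apply: (tri v5 (z := q 6)); last by rewrite sym.
  by rewrite E //; lia.
have sub : nbs e S v \subset [set q 2; q 3; q 4].
  apply/subsetP => y; rewrite inE => /andP[yS vy].
  have : y \in S :\ v by rewrite !inE yS andbT; apply: contraTneq vy => ->; rewrite irr.
  rewrite SE t0 => /in_toset[j jN yE]; rewrite !inE yE.
  (* Vertices 0 and 1 of K_{2,3} are adjacent to vertex 2, which is itself a neighbour of [v]. *)
  case: (ltnP j 2) => j2.
    exfalso; apply: (tri vy (z := q 2)); last by rewrite sym.
    by rewrite yE E ?t0 //; case: j j2 {yE jN} => [|[|]].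
  have : (j == 2) || (j == 3) || (j == 4) by lia.
  by case/orP=> [/orP[]|] /eqP->; rewrite eqxx ?orbT.
have := subset_leq_card sub; rewrite d4 leqNgt; case/negP.
by rewrite -setUA !cardsU1 cards1; do 2!case: (_ \notin _).
Qed.

Lemma ext_or_gap S : ext S \/ gap S.
Proof.
have [n] := ubnP #|S|; elim: n S => // n IHn S; rewrite ltnS => Sn.
have IH X : #|X| < #|S| -> ext X \/ gap X by move=> lt; apply: IHn; apply: leq_trans lt Sn.
case: (set_0Vmem S) => [->|[v0 v0S]].
  (* The empty graph is extremal: no copies of C4, and the numbering is arbitrary. *)
  left; exists 0; rewrite cards0; exists (fun _ => x0); split=> [//||//].
  by apply/setP => y; apply/idP/in_toset; rewrite ?inE // => -[].
case: (boolP [exists v in S, 8 <= #|nbs e S v|]) => [/exists_inP[v vS d8]|].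
  by right; exact: degree_case8 d8 IH.
rewrite negb_exists_in => /forall_inP deg7.
have {}deg7 x : x \in S -> #|nbs e S x| <= 7 by move/deg7; rewrite -ltnNge.
have r4 := ltn_pmod #|S| (isT : 0 < 4).
case: (arg_minnP (fun v => #|nbs e S v|) v0S) => v vS vmin.
case: (arg_maxnP (fun v => #|nbs e S v|) v0S) => w wS wmax.
case: (ltnP #|nbs e S v| 3) => d3.
  have d8 : #|nbs e S v| < 8 by lia.
  have := @certs_ok (#|S| %% 4) _ r4 d8; rewrite d3 (minn_idPl (ltnW d3)) => ch.
  apply: machine_case (real_star vS) (ch _) IH => //.
  by rewrite xpair_eqE negb_and; apply/orP; right; lia.
have d8 : #|nbs e S w| < 8 by rewrite ltnS deg7.
have w3 : 3 <= #|nbs e S w| := leq_trans d3 (wmax v vS).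
have deg3 x : x \in S -> 3 <= #|nbs e S x| by move=> xS; apply: leq_trans d3 (vmin x xS).
case: (eqVneq (#|S| %% 4, #|nbs e S w|) (2, 4)) => [[r2 w4]|ne].
  by right; exact: degree_case4 w4 r2 deg3 IH.
have := certs_ok r4 d8 ne; rewrite (minn_idPr w3) ltnNge w3 /= => ch.
exact: machine_case deg3 wmax (real_star wS) ch IH.
Qed.

End Main.

(** * From numberings to graph isomorphism, and the theorem *)

Lemma graph_iso_numbered (T : finType) (x0 : T) (e : rel T) n g : #|T| = n ->
  graph_iso _ _ e (ord_graph n g) <-> exists q, numbered e n g [set: T] q.
Proof.
move=> Tn; split=> [[h [[k hk kh] he]]|[q [inj SE E]]].
  pose q i := if insub i is Some o then k o else x0.
  have qE i (iN : i < n) : q i = k (Ordinal iN) by rewrite /q insubT.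
  exists q; split.
  - move=> i j iN jN; rewrite (qE i iN) (qE j jN) => /(can_inj kh) [] //.
  - apply/setP => y; rewrite inE; apply/esym/in_toset; exists (h y); first exact: ltn_ord.
    by rewrite (qE _ (ltn_ord _)) -[LHS]hk; congr k; apply: val_inj.
  - by move=> i j iN jN; rewrite (qE i iN) (qE j jN) -he !kh.
pose k (o : 'I_n) := q o.
have kinj : injective k by move=> i j /inj H; apply/val_inj/H.
have [h kh hk] : bijective k by apply: inj_card_bij; rewrite ?card_ord ?Tn.
exists h; split; first by exists k.
by move=> x y; rewrite /ord_graph -E // -/(k _) hk -/(k _) hk.
Qed.

(** Being extremal and being isomorphic to the model coincide, since the order determines the number
    of C4 blocks; a gap is incompatible with equality and hence with isomorphism. *)
Lemma phi_bound (T : finType) (e : rel T) (n t m : nat) (g : rel nat) (c : nat) :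
  simple_graph e -> triangle_free e -> #|T| = n ->
  0 < n -> n = m + 4 * t -> m = rbase (n %% 4) -> f n = 6 * c -> glue m =2 g ->
  phi e <= c /\ (phi e = c <-> graph_iso _ _ e (ord_graph n g)).
Proof.
move=> [sym irr] tri Tn n0 nE mE fn gE.
have /card_gt0P[x0 _] : 0 < #|T| by rewrite Tn.
have sT : #|[set: T]| = n by rewrite cardsT.
have extE : ext e [set: T] <-> graph_iso _ _ e (ord_graph n g).
  rewrite (graph_iso_numbered x0) //; split=> [[t' [q N]]|[q N]].
    have t't : m + 4 * t' = n by have := card_numbered N; rewrite sT -mE.
    rewrite sT -mE t't in N; exists q; apply: numbered_eq N => i j _ _; exact: gE.
  exists t, q; rewrite sT -mE -nE.
  by apply: numbered_eq N => i j _ _; rewrite gE.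
have extc : ext e [set: T] -> phis e [set: T] = c.
  by move/(ext_eq sym); rewrite sT fn; lia.
have [E|G] := ext_or_gap sym irr tri x0 [set: T]; rewrite phi_phis.
  by rewrite (extc E); split=> //; split=> // _; apply/extE.
have := gap_lt G; rewrite sT fn => lt; split; first by lia.
by split=> [eqc|/extE/extc //]; lia.
Qed.

Theorem theorem5p2 (T : finType) (e : rel T) :
  simple_graph e -> triangle_free e -> 4 <= #|T| ->
  forall t r : nat, 0 < t -> r < 4 -> #|T| = 4 * t + r ->
  (r = 0 -> phi e <= 6 ^ t /\
     (phi e = 6 ^ t <-> graph_iso _ _ e (ord_graph (4 * t + r) tC4_rel))) /\
  (r = 1 -> phi e <= 8 * 6 ^ (t - 1) /\
     (phi e = 8 * 6 ^ (t - 1) <-> graph_iso _ _ e (ord_graph (4 * t + r) K23_C4_rel))) /\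
  (r = 2 -> phi e <= 11 * 6 ^ (t - 1) /\
     (phi e = 11 * 6 ^ (t - 1) <-> graph_iso _ _ e (ord_graph (4 * t + r) K33_C4_rel))) /\
  (r = 3 -> phi e <= 3 * 6 ^ t /\
     (phi e = 3 * 6 ^ t <-> graph_iso _ _ e (ord_graph (4 * t + r) P3_C4_rel))).
Proof.
move=> sg tri _ t r t0 r4 nE.
case: t t0 nE => // t _ nE; rewrite subn1 /=.
have rE : (4 * t.+1 + r) %% 4 = r by lia.
split; [|split; [|split]] => r0; rewrite {r4}r0 in rE nE *.
(* For r = 1 and r = 2 the base component has 4 + r vertices and so replaces one of the blocks of
   four; for r = 0 and r = 3 all of them are copies of C4. *)
- by apply: (phi_bound (m := 0) (t := t.+1)); rewrite // ?rE ?f_add4 ?fE //; lia.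
- by apply: (phi_bound (m := 5) (t := t)); rewrite // ?rE ?f_add4 ?fE ?expnS //; lia.
- by apply: (phi_bound (m := 6) (t := t)); rewrite // ?rE ?f_add4 ?fE ?expnS //; lia.
- by apply: (phi_bound (m := 3) (t := t.+1)); rewrite // ?rE ?f_add4 ?fE //; lia.
Qed.
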